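(* Let $(n_k)_{k\in\mathbb{N}}$ be an increasing sequence of natural numbers with nested spectrums which has unbounded variation, i.e. $\sup_kV(n_k)=\infty$. Then for every $\varphi\in\Phi$ with $\varphi(u)=o(\varphi_{(n_k)}(u))$ $(u\to\infty)$ there exists a function $f\in\varphi(L)[0,1)$ such that $\sup_{k\in\mathbb{N}}|S_{n_k}(f)(x)|=\infty$ for every $x\in[0,1)$.
   Context: $\mathbb{N}_0$ is the set of non-negative integers. Let $r:\mathbb{R}\to\mathbb{R}$ be the $1$-periodic function with $r(x)=1$ for $x\in[0,1/2)$ and $r(x)=-1$ for $x\in[1/2,1)$, and let $r_n(x)=r(2^nx)$ $(n\in\mathbb{N}_0,\ x\in[0,1))$ be the Rademacher functions. For $n\in\mathbb{N}_0$ let $\varepsilon_j(n)\in\{0,1\}$ $(j\in\mathbb{N}_0)$ be its binary coefficients, $n=\sum_{j=0}^\infty\varepsilon_j(n)2^j$. The Walsh system is $w_n(x)=\prod_{j=0}^\infty r_j(x)^{\varepsilon_j(n)}$ $(n\in\mathbb{N}_0,\ x\in[0,1))$. For $f\in L[0,1)$ (Lebesgue integrable), the partial Walsh-Fourier sums are $S_n(f)=\sum_{k=0}^{n-1}\widehat f(k)w_k$, where $\widehat f(k)=\int_{[0,1)}fw_k$. The variation of $n\in\mathbb{N}_0$ is $V(n)=\varepsilon_0(n)+\sum_{j=1}^\infty|\varepsilon_j(n)-\varepsilon_{j-1}(n)|$. A sequence $(n_k)$ has bounded variation if $\sup_kV(n_k)<\infty$, and unbounded variation otherwise. The spectrum of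 $n$ is $\mathrm{Sp}(n)=\{j\in\mathbb{N}_0:\varepsilon_j(n)=1\}$. A sequence with nested spectrums is an increasing sequence of natural numbers $(n_k)_{k\in\mathbb{N}}$ (natural numbers are positive integers) such that $\mathrm{Sp}(n_{k+1})\cap[0,\max\mathrm{Sp}(n_k)]=\mathrm{Sp}(n_k)$ for every $k\in\mathbb{N}$. For an increasing sequence $(n_k)$ of natural numbers with nested spectrums and unbounded variation, $\varphi_{(n_k)}:[0,\infty)\to[0,\infty)$ is the function defined by: $\varphi_{(n_k)}(2^{2n_\nu})=2^{2n_\nu}V(n_\nu)$ for every $\nu\in\mathbb{N}$; $\varphi_{(n_k)}(0)=0$ and $\varphi_{(n_k)}$ is linear on $[0,2^{2n_1}]$; $\varphi_{(n_k)}$ is linear on $[2^{2n_\nu},2^{2n_{\nu+1}}]$ for every $\nu\in\mathbb{N}$. $\Phi$ denotes the set of all non-decreasing functions $\varphi:[0,\infty)\to[0,\infty)$ with $\liminf_{u\to\infty}\varphi(u)/u>0$. For a non-decreasing function $\varphi:[0,\infty)\to[0,\infty)$, $\varphi(L)[0,1)$ denotes the class of all measurable $f:[0,1)\to\mathbb{R}$ with $\int_{[0,1)}\varphi(|f|)<\infty$; for $\varphi\in\Phi$ one has $\varphi(L)[0,1)\subset L[0,1)$. *)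

(* Defs.v *)
From HB Require Import structures.
From mathcomp Require Import all_boot all_order all_algebra.
From mathcomp Require Import all_classical all_reals all_analysis.

Set Implicit Arguments.
Unset Strict Implicit.
Unset Printing Implicit Defensive.

Import Order.TTheory GRing.Theory Num.Theory.
Import numFieldNormedType.Exports.

Local Open Scope classical_set_scope.
Local Open Scope ring_scope.

Definition eps (j n : nat) : nat := odd (n %/ 2 ^ j)%N.

Definition Sp (n : nat) : set nat := [set j | eps j n = 1%N].

(* [eps j n = 1] forces [2 ^ j <= n], hence [j < n]: bounding by [n] the index
   [j] in [max_Sp] and in the product [walsh], and by [n.+1] in the sum
   [bin_variation] (whose terms also involve [eps j.-1 n]), drops only trivial
   terms. *)
Definition max_Sp (n : nat) : nat := (\max_(j < n | eps j n == 1) j)%N.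

Definition bin_variation (n : nat) : nat :=
  (eps 0 n + \sum_(1 <= j < n.+1) `|eps j n - eps j.-1 n|)%N.

(* Sequences are indexed by [k : nat], from 0 instead of from 1. *)
Definition nested_spectrums (n : nat -> nat) : Prop :=
  [/\ forall k, (0 < n k)%N,
      forall k, (n k < n k.+1)%N &
      forall k, Sp (n k.+1) `&` [set j | (j <= max_Sp (n k))%N] = Sp (n k)].

(* Required by the Landau notation [=o_(u \near pinfty_nbhs R)]. *)
Canonical pinfty_filter_on (R : numFieldType) : filter_on R :=
  FilterType (pinfty_nbhs R) _.

Section Walsh.
Variable R : realType.
Implicit Types (f phi : R -> R) (n : nat) (x : R).

Definition unit_itv : set R := `[0, 1[%classic.

Definition rad0 x : R := if x - (Num.floor x)%:~R < 2^-1 then 1 else -1.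

Definition rademacher n x : R := rad0 (2 ^+ n * x).

Definition walsh n x : R := \prod_(j < n) rademacher j x ^+ eps j n.

Definition walsh_coef f (k : nat) : R :=
  \int[lebesgue_measure]_(x in unit_itv) (f x * walsh k x).

Definition walsh_sum n f x : R := \sum_(k < n) walsh_coef f k * walsh k x.

(* A function on [0, oo) is represented by a function on [R], of which only the
   values at nonnegative arguments matter; likewise for functions on [0, 1). *)
Definition nondecreasing_nonneg phi : Prop :=
  (forall u, 0 <= u -> 0 <= phi u) /\
  (forall u v, 0 <= u -> u <= v -> phi u <= phi v).

Definition Phi : set (R -> R) :=
  [set phi : R -> R | nondecreasing_nonneg phi /\
     (0 < limf_einf (fun u : R => (phi u / u)%:E) (pinfty_nbhs R))%E].

Definition phiL phi : set (R -> R) :=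
  [set f : R -> R | measurable_fun unit_itv f /\
     (\int[lebesgue_measure]_(x in unit_itv) (phi `|f x|)%:E < +oo)%E].

(* The nodes and the values of the piecewise linear function [phi_seq]; the
   node of index [0] is the origin. *)
Definition node (nk : nat -> nat) (i : nat) : R :=
  if i is k.+1 then 2 ^+ (2 * nk k) else 0.

Definition node_val (nk : nat -> nat) (i : nat) : R :=
  if i is k.+1 then 2 ^+ (2 * nk k) * (bin_variation (nk k))%:R else 0.

Definition chord (a b ya yb u : R) : R := ya + (yb - ya) / (b - a) * (u - a).

Definition phi_seq (nk : nat -> nat) (u : R) : R :=
  let i := [get i | node nk i <= u < node nk i.+1] in
  chord (node nk i) (node nk i.+1) (node_val nk i) (node_val nk i.+1) u.

Section PhiSeq.
Variables (nk : nat -> nat) (nk_incr : forall k, (nk k < nk k.+1)%N).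

Lemma node_lt i : node nk i < node nk i.+1.
Proof.
case: i => [|k] /=; first by rewrite exprn_gt0.
by rewrite ltr_eXn2l ?ltr1n // ltn_mul2l /=.
Qed.

Lemma node_le i j : (i <= j)%N -> node nk i <= node nk j.
Proof.
by apply: (@homo_leq _ (node nk) (fun x y => x <= y)) => //;
  [exact: le_trans | move=> k; exact/ltW/node_lt].
Qed.

Lemma phi_seqE i u : node nk i <= u <= node nk i.+1 ->
  phi_seq nk u =
  chord (node nk i) (node nk i.+1) (node_val nk i) (node_val nk i.+1) u.
Proof.
have get_node j v : node nk j <= v < node nk j.+1 ->
    [get l | node nk l <= v < node nk l.+1] = j.
  move=> Hj; case: xgetP => [l _ /= /andP[Hl1 Hl2]|/(_ j) /(_ Hj)//].
  move/andP: Hj => [Hj1 Hj2]; apply/eqP; rewrite eqn_leq.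
  by apply/andP; split; rewrite leqNgt; apply/negP => /node_le; rewrite leNgt;
    move/negP; apply; [exact: le_lt_trans Hl1 _ | exact: le_lt_trans Hj1 _].
move=> /andP[iu]; rewrite le_eqVlt => /orP[/eqP -> |ui]; last first.
  by rewrite /phi_seq (get_node i) // iu ui.
rewrite /phi_seq (get_node i.+1) ?lexx ?node_lt// /chord subrr mulr0 addr0.
rewrite divfK ?subr_eq0 ?gt_eqF ?node_lt//.
by rewrite addrC subrK.
Qed.

Lemma phi_seq0 : phi_seq nk 0 = 0.
Proof.
rewrite (@phi_seqE 0%N) /chord /= ?subrr ?mulr0 ?addr0//.
by rewrite lexx exprn_ge0.
Qed.

Lemma phi_seq_pow k :
  phi_seq nk (2 ^+ (2 * nk k)) = 2 ^+ (2 * nk k) * (bin_variation (nk k))%:R.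
Proof.
rewrite (@phi_seqE k.+1) /chord /= ?subrr ?mulr0 ?addr0//.
by rewrite lexx /= (ltW (node_lt k.+1)).
Qed.

End PhiSeq.

End Walsh.

(* Main.v *)
Require Import Defs.
From HB Require Import structures.
From mathcomp Require Import all_boot all_order all_algebra.
From mathcomp Require Import all_classical all_reals all_analysis.
From mathcomp Require Import measurable_realfun ring lra.

(** Write [M k] for the top digit of [nk k]. Fix [nu], put [N = M nu + 1], and
    let [sigma] be a function of the first [N] digits. Since the spectra are
    nested, for [k > nu] the partial sum of order [nk k] of [w_(nk k) * sigma]
    is [w_(nk k) * T sigma], where [T] keeps the martingale differences of
    [sigma] at the levels in [Sp (nk nu)]. For every [x] there is a [sigma] with
    values [1] and [-1], depending only on the first [N] digits of [x], such
    that [sigma x = 1] and [T sigma x >= V (nk nu) / 4].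

    As [sigma] runs through these [2 ^ N <= 2 * nk nu] functions, multiply the
    factors [1 + sigma_i * w_(nk (nu + 1 + i))]. All terms of the expanded
    product whose top frequency is [nk k] lie below [nk k], hence are kept by
    the partial sum of order [nk k], except [sigma_i * w_(nk k)]. So this partial
    sum is the nonnegative product of the first factors, plus a bounded term,
    plus [w_(nk k) * T sigma_i], and at every [x] some [k] makes it at least
    [V (nk nu) / 4 - 1] in absolute value. With [2 * nk nu + s] factors and the
    normalization [2 ^ - s], the product takes the values [0] and
    [2 ^ (2 * nk nu)] and has mean [2 ^ - s], so its [phi]-integral is
    [o (2 ^ - s * V (nk nu))]. The function [f] is a sum of such products, each
    chosen so that its partial sums dominate the earlier ones and that the later
    ones are negligible. *)

Set Implicit Arguments.
Unset Strict Implicit.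
Unset Printing Implicit Defensive.

Import Order.TTheory GRing.Theory Num.Theory.
Import numFieldNormedType.Exports.

Local Open Scope classical_set_scope.
Local Open Scope ring_scope.

(** * Binary digits, the top digit and the variation *)

Lemma epsE01 j n : eps j n = (eps j n == 1%N).
Proof. by rewrite /eps; case: odd. Qed.

Lemma eps_small j n : (n < 2 ^ j)%N -> eps j n = 0%N.
Proof. by move=> nj; rewrite /eps divn_small. Qed.

Lemma eps_addn_high m a i j : (i < 2 ^ m)%N -> (m <= j)%N ->
  eps j (a * 2 ^ m + i) = eps j (a * 2 ^ m).
Proof.
move=> im mj; rewrite /eps -(subnKC mj) expnD !divnMA divnMDl ?expn_gt0//.
by rewrite (divn_small im) addn0 mulnK ?expn_gt0.
Qed.

Lemma eps_addn_low m a i j : (j < m)%N -> eps j (a * 2 ^ m + i) = eps j i.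
Proof.
move=> jm; rewrite /eps -(subnK (ltnW jm)) expnD mulnA divnMDl ?expn_gt0//.
by rewrite oddD oddM oddX /= subn_eq0 leqNgt jm /= andbF.
Qed.

Lemma eps_trunc_log n : (0 < n)%N -> eps (trunc_log 2 n) n = 1%N.
Proof.
move=> n0; have /andP[l u] := @trunc_log_bounds 2 n isT n0.
rewrite /eps; suff -> : (n %/ 2 ^ trunc_log 2 n)%N = 1%N by [].
apply/eqP; rewrite eqn_leq -ltnS ltn_divLR ?expn_gt0// -expnS u /=.
by rewrite leq_divRL ?expn_gt0// mul1n.
Qed.

Lemma max_SpE n : (0 < n)%N -> max_Sp n = trunc_log 2 n.
Proof.
move=> n0; apply/eqP; rewrite eqn_leq; apply/andP; split.
  apply/bigmax_leqP => j /eqP ej; rewrite leqNgt; apply/negP => jl.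
  have nj : (n < 2 ^ j)%N.
    by rewrite (leq_trans (trunc_log_ltn n (isT : 1 < 2)%N))// leq_pexp2l.
  by rewrite eps_small in ej.
have ln : (trunc_log 2 n < n)%N.
  by rewrite (leq_trans (ltn_expl _ (isT : 1 < 2)%N))// trunc_logP.
by rewrite /max_Sp (bigD1 (Ordinal ln)) /= ?leq_maxl// eps_trunc_log.
Qed.

(** Digits above the top one vanish, so the last possible change is the fall from the top digit to
    [0], which is the term [j = trunc_log 2 n]. *)
Lemma bin_variationE n : bin_variation n =
  (eps 0 n + \sum_(j < (trunc_log 2 n).+1) `|eps j.+1 n - eps j n|)%N.
Proof.
case: n => [|n]; first by rewrite /bin_variation trunc_log0 big_geq// big_ord1 /eps.
set l := trunc_log 2 _; rewrite /bin_variation; congr addn.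
have ln : (l < n.+1)%N.
  by rewrite (leq_trans (ltn_expl _ (isT : 1 < 2)%N))// trunc_logP.
rewrite (@big_cat_nat _ _ _ l.+2) //= [X in (_ + X)%N](_ : _ = 0%N) ?addn0.
  by rewrite big_add1 /= big_mkord.
rewrite big_nat_cond big1// => -[|j]; rewrite andbT ?ltn0// => /andP[lj _] /=.
have nl : (n.+1 < 2 ^ l.+1)%N by exact: trunc_log_ltn.
rewrite !eps_small// (leq_trans nl)// leq_pexp2l//.
by rewrite (leq_trans _ lj).
Qed.

Lemma eps_inj p n m : (n < 2 ^ p)%N -> (m < 2 ^ p)%N ->
  (forall j, (j < p)%N -> eps j n = eps j m) -> n = m.
Proof.
elim: p n m => [|p IH] n m; first by rewrite expn0 !ltnS !leqn0 => /eqP-> /eqP->.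
move=> np mp e.
have half : n./2 = m./2.
  rewrite -!divn2; apply: IH; rewrite ?ltn_divLR// -?expnSr// => j jp.
  by have := e j.+1 jp; rewrite /eps expnS !divnMA.
have := e 0%N isT; rewrite /eps expn0 !divn1 => on.
by rewrite -(odd_double_half n) -(odd_double_half m) half on.
Qed.

(** * Sequences with nested spectra *)

Section Nested.
Variables (nk : nat -> nat) (nkP : nested_spectrums nk).

Let nk_gt0 k : (0 < nk k)%N. Proof. by case: nkP. Qed.

Lemma nested_ltn : {homo nk : i j / (i < j)%N}.
Proof. by apply: homo_ltn ltn_trans _ => k; case: nkP. Qed.

Lemma nested_leq : {homo nk : i j / (i <= j)%N}.
Proof. by apply: (homo_leq leqnn leq_trans) => k; apply/ltnW/nested_ltn. Qed.

Definition top_digit k := trunc_log 2 (nk k).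

Lemma nested_eps k j : (j <= top_digit k)%N -> eps j (nk k.+1) = eps j (nk k).
Proof.
move=> jk; case: nkP => _ _ /(_ k); rewrite max_SpE// => /seteqP[h1 h2].
rewrite epsE01 [RHS]epsE01; congr nat_of_bool.
apply/eqP/eqP => ej; first exact: (h1 j).
by have [] := h2 j ej.
Qed.

(** If the top digit did not grow, [nk k.+1] would have no digit above [top_digit k] and would agree
    with [nk k] up to there, hence be equal to it. *)
Lemma top_ltn : {homo top_digit : i j / (i < j)%N}.
Proof.
apply: homo_ltn ltn_trans _ => k; rewrite ltnNge; apply/negP => kk.
suff : (nk k.+1 <= nk k)%N by rewrite leqNgt nested_ltn.
have := trunc_log_ltn (nk k.+1) (isT : 1 < 2)%N; rewrite -/(top_digit _) => lt1.
have lt2 : (nk k.+1 < 2 ^ (top_digit k).+1)%N by rewrite (leq_trans lt1)// leq_pexp2l.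
have lt3 : (nk k < 2 ^ (top_digit k).+1)%N by exact: trunc_log_ltn.
rewrite leq_eqVlt; apply/orP; left; apply/eqP.
by apply: eps_inj lt2 lt3 _ => j; rewrite ltnS => /nested_eps.
Qed.

Lemma top_leq : {homo top_digit : i j / (i <= j)%N}.
Proof. by apply: (homo_leq leqnn leq_trans) => k; apply/ltnW/top_ltn. Qed.

Lemma nested_eps_leq k l j : (k <= l)%N -> (j <= top_digit k)%N ->
  eps j (nk l) = eps j (nk k).
Proof.
move=> /subnK <- jk; elim: (l - k)%N => [//|d IH].
by rewrite addSn nested_eps// (leq_trans jk)// top_leq// leq_addl.
Qed.

Lemma nested_eps_top k l : (k <= l)%N -> eps (top_digit k) (nk l) = 1%N.
Proof. by move=> kl; rewrite (nested_eps_leq kl)// eps_trunc_log. Qed.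

Lemma leq_top k : (2 ^ top_digit k <= nk k)%N.
Proof. exact: trunc_logP. Qed.

Lemma ltn_topS k : (nk k < 2 ^ (top_digit k).+1)%N.
Proof. exact: trunc_log_ltn. Qed.

End Nested.

(** * Walsh functions and dyadic polynomials *)

Section DyadicPolynomials.
Variable R : realType.
Implicit Types (P Q : R -> R) (x y : R) (m n i j : nat).

Lemma rademacher_or j x : rademacher j x = 1 \/ rademacher j x = -1.
Proof. by rewrite /rademacher /rad0; case: ifP; [left|right]. Qed.

Lemma rademacher_sq j x : rademacher j x * rademacher j x = 1.
Proof. by case: (rademacher_or j x) => ->; rewrite ?mulrNN mulr1. Qed.

(** With a free length [J], Walsh functions of different indices become products over the same
    range. *)
Lemma walshE J n x : (n < 2 ^ J)%N ->
  walsh n x = \prod_(j < J) rademacher j x ^+ eps j n.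
Proof.
move=> nJ; rewrite /walsh.
rewrite -(big_mkord xpredT (fun j => rademacher j x ^+ eps j n)).
rewrite -(big_mkord xpredT (fun j => rademacher j x ^+ eps j n)).
have tail a b : (n < 2 ^ a)%N -> \prod_(a <= j < b) rademacher j x ^+ eps j n = 1.
  move=> na; rewrite big_nat_cond big1// => j; rewrite andbT => /andP[aj _].
  by rewrite eps_small ?expr0// (leq_trans na)// leq_pexp2l.
have [Jn|/ltnW Jn] := leqP J n.
  by rewrite (@big_cat_nat _ _ _ J)//= (tail J)// mulr1.
by rewrite [RHS](@big_cat_nat _ _ _ n)//= (tail n) ?mulr1// ltn_expl.
Qed.

Lemma walsh0 x : walsh 0 x = 1.
Proof. by rewrite /walsh big_ord0. Qed.

(** The two summands have disjoint spectra, so no carry occurs and the digits add. *)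
Lemma walshD m a i x : (i < 2 ^ m)%N ->
  walsh (a * 2 ^ m + i) x = walsh (a * 2 ^ m) x * walsh i x.
Proof.
move=> im; pose J := (a * 2 ^ m + i)%N.
have hJ k : (k <= J)%N -> (k < 2 ^ J)%N.
  by move=> kJ; rewrite (leq_ltn_trans kJ)// ltn_expl.
rewrite !(@walshE J) ?hJ ?leqnn ?leq_addr ?leq_addl//.
rewrite -big_split /=; apply: eq_bigr => j _; rewrite -exprD; congr (_ ^+ _).
have [mj|jm] := leqP m j.
  rewrite eps_addn_high// (@eps_small _ i) ?addn0//.
  by rewrite (leq_trans im)// leq_pexp2l.
rewrite eps_addn_low// -[(a * _)%N]addn0 eps_addn_low//.
by rewrite (@eps_small _ 0) ?expn_gt0.
Qed.

Lemma walsh_pow2 m x : walsh (2 ^ m) x = rademacher m x.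
Proof.
rewrite (@walshE m.+1) ?ltn_exp2l// big_ord_recr /= big1 ?mul1r => [|j _].
  by rewrite /eps divnn expn_gt0 expr1.
by rewrite -[(2 ^ m)%N]mul1n -[(1 * _)%N]addn0 eps_addn_low// eps_small ?expn_gt0.
Qed.

Lemma walshD_pow2 m i x : (i < 2 ^ m)%N ->
  walsh (2 ^ m + i) x = rademacher m x * walsh i x.
Proof. by move=> im; rewrite -[(2 ^ m)%N]mul1n walshD// mul1n walsh_pow2. Qed.

(* The functions depending only on the first [m] binary digits, i.e. the span
   of the Walsh functions of index less than [2 ^ m]. *)
Fixpoint dpoly m Q : Prop :=
  if m is m'.+1 then exists Q0 Q1, [/\ dpoly m' Q0, dpoly m' Q1 &
    forall x, Q x = Q0 x + rademacher m' x * Q1 x]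
  else exists c, forall x, Q x = c.

Lemma dpoly_ext m P Q : P =1 Q -> dpoly m P -> dpoly m Q.
Proof. by move=> /funext ->. Qed.

Lemma dpoly_cst m c : dpoly m (fun=> c).
Proof.
elim: m c => [|m IH] c; first by exists c.
by exists (fun=> c), (fun=> 0); split=> // x; rewrite mulr0 addr0.
Qed.

Lemma dpolyS m Q : dpoly m Q -> dpoly m.+1 Q.
Proof.
move=> Qm; exists Q, (fun=> 0); split=> //; first exact: dpoly_cst.
by move=> x; rewrite mulr0 addr0.
Qed.

Lemma dpoly_leq m n Q : (m <= n)%N -> dpoly m Q -> dpoly n Q.
Proof.
by move=> /subnK <-; elim: (n - m)%N => // d IH /IH /dpolyS; rewrite addSn.
Qed.

Lemma dpolyD m P Q : dpoly m P -> dpoly m Q -> dpoly m (fun x => P x + Q x).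
Proof.
elim: m P Q => [|m IH] P Q.
  by move=> [a Pa] [b Qb]; exists (a + b) => x; rewrite Pa Qb.
move=> [P0 [P1 [P0m P1m PE]]] [Q0 [Q1 [Q0m Q1m QE]]].
exists (fun x => P0 x + Q0 x), (fun x => P1 x + Q1 x).
by split; [exact: IH|exact: IH|move=> x; rewrite PE QE; ring].
Qed.

Lemma dpolyM m P Q : dpoly m P -> dpoly m Q -> dpoly m (fun x => P x * Q x).
Proof.
elim: m P Q => [|m IH] P Q.
  by move=> [a Pa] [b Qb]; exists (a * b) => x; rewrite Pa Qb.
move=> [P0 [P1 [P0m P1m PE]]] [Q0 [Q1 [Q0m Q1m QE]]].
exists (fun x => P0 x * Q0 x + P1 x * Q1 x), (fun x => P0 x * Q1 x + P1 x * Q0 x).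
split; [by apply: dpolyD; apply: IH|by apply: dpolyD; apply: IH|move=> x].
by rewrite PE QE; case: (rademacher_or m x) => ->; ring.
Qed.

Lemma dpolyZ m c Q : dpoly m Q -> dpoly m (fun x => c * Q x).
Proof. exact/dpolyM/dpoly_cst. Qed.

Lemma dpoly_sum m (I : Type) (r : seq I) (p : pred I) (F : I -> R -> R) :
  (forall a, p a -> dpoly m (F a)) -> dpoly m (fun x => \sum_(a <- r | p a) F a x).
Proof.
move=> Fm; elim: r => [|a r IH].
  by apply: dpoly_ext (dpoly_cst m 0) => x; rewrite big_nil.
have [pa|pa] := boolP (p a).
  by apply: dpoly_ext (dpolyD (Fm _ pa) IH) => x; rewrite big_cons pa.
by apply: dpoly_ext IH => x; rewrite big_cons (negbTE pa).
Qed.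

Lemma dpoly_prod m (I : Type) (r : seq I) (p : pred I) (F : I -> R -> R) :
  (forall a, p a -> dpoly m (F a)) -> dpoly m (fun x => \prod_(a <- r | p a) F a x).
Proof.
move=> Fm; elim: r => [|a r IH].
  by apply: dpoly_ext (dpoly_cst m 1) => x; rewrite big_nil.
have [pa|pa] := boolP (p a).
  by apply: dpoly_ext (dpolyM (Fm _ pa) IH) => x; rewrite big_cons pa.
by apply: dpoly_ext IH => x; rewrite big_cons (negbTE pa).
Qed.

Lemma dpoly_rademacher m j : (j < m)%N -> dpoly m (rademacher j : R -> R).
Proof.
move=> jm; apply: (dpoly_leq jm); exists (fun=> 0), (fun=> 1).
by split; [exact: dpoly_cst|exact: dpoly_cst|move=> x; rewrite mulr1 add0r].
Qed.

Lemma dpoly_walsh m n : (n < 2 ^ m)%N -> dpoly m (walsh n : R -> R).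
Proof.
move=> nm; have E x := esym (walshE x nm); apply: dpoly_ext E _.
apply: dpoly_prod => j _.
have [e|e] : eps j n = 0%N \/ eps j n = 1%N by rewrite /eps; case: odd; [right|left].
  by rewrite e; apply: dpoly_ext (dpoly_cst m 1) => x; rewrite expr0.
by apply: dpoly_ext (dpoly_rademacher (ltn_ord j)) => x; rewrite e expr1.
Qed.

(** By [walshD_pow2], [Q0] supplies the coefficients of index below [2 ^ m] and [Q1], shifted by
    [2 ^ m], the others. *)
Lemma dpoly_walsh_expansion m Q : dpoly m Q ->
  exists c : nat -> R, forall x, Q x = \sum_(i < 2 ^ m) c i * walsh i x.
Proof.
elim: m Q => [|m IH] Q.
  by move=> [c Qc]; exists (fun=> c) => x; rewrite big_ord1 walsh0 mulr1.
move=> [Q0 [Q1 [/IH [c0 Q0E] /IH [c1 Q1E] QE]]].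
exists (fun i => if (i < 2 ^ m)%N then c0 i else c1 (i - 2 ^ m)%N) => x.
rewrite QE Q0E Q1E expnS mul2n -addnn big_split_ord /=; congr (_ + _).
  by apply: eq_bigr => i _; rewrite ltn_ord.
rewrite mulr_sumr; apply: eq_bigr => i _.
by rewrite ltnNge leq_addr /= addKn walshD_pow2// mulrCA.
Qed.

Lemma dpoly_bounded m Q : dpoly m Q -> exists C, forall x, `|Q x| <= C.
Proof.
elim: m Q => [|m IH] Q; first by move=> [c Qc]; exists `|c| => x; rewrite Qc.
move=> [Q0 [Q1 [/IH [c0 Q0E] /IH [c1 Q1E] QE]]]; exists (c0 + c1) => x.
rewrite QE (le_trans (ler_normD _ _))// lerD// normrM.
by case: (rademacher_or m x) => ->; rewrite ?normrN normr1 mul1r.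
Qed.

Lemma rademacher_dyadic j x (p : nat) :
  p%:R <= 2 ^+ j.+1 * x < p%:R + 1 -> rademacher j x = (-1) ^+ p.
Proof.
move=> /andP[l u]; rewrite /rademacher /rad0.
have E : (p = odd p + p./2 * 2)%N by rewrite muln2 odd_double_half.
have EE : p%:R = (odd p)%:R + p./2%:R * 2 :> R by rewrite {1}E natrD natrM.
move: l u; rewrite exprS -mulrA EE => l u.
have -> : Num.floor (2 ^+ j * x) = p./2%:Z.
  apply: floor_def; rewrite intrD -!pmulrn.
  by move: l u; case: (odd p) => /= l u; lra.
rewrite -signr_odd -!pmulrn; move: l u; case: (odd p) => /= l u.
  by rewrite ifF ?expr1//; apply/negbTE; rewrite -leNgt; lra.
by rewrite ifT ?expr0//; lra.
Qed.

Lemma dpoly_dyadic m Q x y (p : nat) : dpoly m Q ->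
  p%:R <= 2 ^+ m * x < p%:R + 1 -> p%:R <= 2 ^+ m * y < p%:R + 1 -> Q x = Q y.
Proof.
elim: m Q p => [|m IH] Q p; first by move=> [c Qc]; rewrite !Qc.
move=> [Q0 [Q1 [Q0m Q1m QE]]] px py.
rewrite !QE (rademacher_dyadic px) (rademacher_dyadic py).
have half (z : R) : p%:R <= 2 ^+ m.+1 * z < p%:R + 1 ->
    p./2%:R <= 2 ^+ m * z < p./2%:R + 1.
  have E : (p = odd p + p./2 * 2)%N by rewrite muln2 odd_double_half.
  have EE : p%:R = (odd p)%:R + p./2%:R * 2 :> R by rewrite {1}E natrD natrM.
  by rewrite exprS -mulrA EE; case: (odd p) => /=; lra.
by rewrite (IH Q0 _ Q0m (half _ px) (half _ py)) (IH Q1 _ Q1m (half _ px) (half _ py)).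
Qed.

End DyadicPolynomials.

(** * Orthonormality and partial sums of dyadic polynomials *)

Section WalshIntegrals.
Variable R : realType.
Implicit Types (f g P Q : R -> R) (x y : R) (m n i j k : nat).

Local Notation mu := (@lebesgue_measure R).
Local Notation D := (@unit_itv R).
Local Notation integrableD f := (mu.-integrable D (EFin \o f)).

Lemma measurable_unit_itv : measurable D.
Proof. exact: measurable_itv. Qed.
Local Hint Resolve measurable_unit_itv : core.

Lemma measurable_rademacher j : measurable_fun setT (rademacher j : R -> R).
Proof.
rewrite /rademacher /rad0; apply: measurable_fun_ifT => //.
apply: measurable_fun_ltr => //; apply: measurable_funB.
  by apply: measurable_funM => //; exact: measurable_id.
apply: nondecreasing_measurable => // x y xy.
by rewrite ler_int le_floor// ler_pM2l ?exprn_gt0.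
Qed.

Lemma dpoly_measurable m Q : dpoly m Q -> measurable_fun setT Q.
Proof.
elim: m Q => [|m IH] Q; first by move=> [c Qc]; rewrite (_ : Q = cst c)//; apply/funext.
move=> [Q0 [Q1 [/IH m0 /IH m1 QE]]].
rewrite (_ : Q = fun x => Q0 x + rademacher m x * Q1 x); last exact/funext.
by apply: measurable_funD => //; apply: measurable_funM => //;
  exact: measurable_rademacher.
Qed.

Lemma dpoly_integrable m Q (A : set R) : dpoly m Q -> measurable A ->
  (mu A < +oo)%E -> mu.-integrable A (EFin \o Q).
Proof.
move=> Qm mA A_fin; apply: measurable_bounded_integrable => //.
  by apply: measurable_funTS; exact: dpoly_measurable Qm.
have [C QC] := dpoly_bounded Qm.
by exists C; split; [exact: num_real|move=> M CM x _; exact: le_trans (QC x) (ltW CM)].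
Qed.

Lemma lebesgue_unit_itv : mu D = 1%E.
Proof. by rewrite /unit_itv lebesgue_measure_itv /= lte_fin ltr01 oppr0 adde0. Qed.

Lemma dpoly_integrableD m Q : dpoly m Q -> integrableD Q.
Proof.
by move=> Qm; apply: (dpoly_integrable Qm); rewrite ?lebesgue_unit_itv ?ltry.
Qed.

Lemma walsh_pm k x : walsh k x = 1 \/ walsh k x = -1.
Proof.
rewrite /walsh; elim/big_ind: _ => [|a b|i _]; first by left.
  by move=> [->|->] [->|->]; rewrite ?mulrNN ?mulr1 ?mul1r; auto.
by rewrite epsE01; case: eqP => _; rewrite ?expr1 ?expr0; [exact: rademacher_or|left].
Qed.

Lemma integrable_mul_walsh f k : integrableD f -> integrableD (fun x => f x * walsh k x).
Proof.
move=> fi; have /integrableP[mf _] := fi; apply: le_integrable fi => //.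
  apply/measurable_EFinP; apply: measurable_funM; first exact/measurable_EFinP.
  apply: measurable_funTS; apply: (@dpoly_measurable k); apply: dpoly_walsh.
  exact: ltn_expl.
move=> x _; rewrite /= lee_fin normrM.
by case: (walsh_pm k x) => ->; rewrite ?normrN normr1 mulr1.
Qed.

Lemma walsh_coefD f g k : integrableD f -> integrableD g ->
  walsh_coef (fun x => f x + g x) k = walsh_coef f k + walsh_coef g k.
Proof.
move=> fi gi; rewrite /walsh_coef -RintegralD//; try exact: integrable_mul_walsh.
by apply: eq_Rintegral => x _; rewrite mulrDl.
Qed.

Lemma walsh_coefZ f a k : integrableD f ->
  walsh_coef (fun x => a * f x) k = a * walsh_coef f k.
Proof.
move=> fi; rewrite /walsh_coef -RintegralZl//; last exact: integrable_mul_walsh.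
by apply: eq_Rintegral => x _; rewrite mulrA.
Qed.

Lemma walsh_sumD n f g x : integrableD f -> integrableD g ->
  walsh_sum n (fun y => f y + g y) x = walsh_sum n f x + walsh_sum n g x.
Proof.
move=> fi gi; rewrite /walsh_sum -big_split /=; apply: eq_bigr => k _.
by rewrite walsh_coefD// mulrDl.
Qed.

Lemma walsh_sumZ n f a x : integrableD f ->
  walsh_sum n (fun y => a * f y) x = a * walsh_sum n f x.
Proof.
move=> fi; rewrite /walsh_sum mulr_sumr; apply: eq_bigr => k _.
by rewrite walsh_coefZ// mulrA.
Qed.

Lemma walsh_sum_bound n f x : integrableD f ->
  `|walsh_sum n f x| <= n%:R * \int[mu]_(t in D) `|f t|.
Proof.
move=> fi; apply: (le_trans (ler_norm_sum _ _ _)).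
rewrite -[n in n%:R]card_ord mulr_natl -sumr_const; apply: ler_sum => k _.
rewrite normrM; have -> : `|walsh k x| = 1.
  by case: (walsh_pm k x) => ->; rewrite ?normrN normr1.
rewrite mulr1; apply: (le_trans (le_normr_Rintegral _ _)) => //.
  exact: integrable_mul_walsh.
rewrite le_eqVlt; apply/orP; left; apply/eqP; apply: eq_Rintegral => t _.
by rewrite normrM; case: (walsh_pm k t) => ->; rewrite ?normrN normr1 mulr1.
Qed.

Lemma dyadic_itv_integral m Q p : dpoly m Q ->
  \int[mu]_(x in `[p%:R / 2 ^+ m, p.+1%:R / 2 ^+ m[) Q x =
    Q (p%:R / 2 ^+ m) / 2 ^+ m.
Proof.
move=> Qm; have m0 : (0 : R) < 2 ^+ m by rewrite exprn_gt0.
rewrite (@eq_Rintegral _ _ _ mu _ (fun=> Q (p%:R / 2 ^+ m))); last first.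
  move=> x; rewrite inE /= in_itv /= ler_pdivrMr// ltr_pdivlMr// => /andP[px xp].
  apply: (dpoly_dyadic Qm (p := p)); first by rewrite [_ * x]mulrC px natr1.
  by rewrite [_ * (_ / _)]mulrC divfK ?lt0r_neq0// lexx ltrDl ltr01.
rewrite Rintegral_cst//; congr (_ * _).
have E : mu `[p%:R / 2 ^+ m, p.+1%:R / 2 ^+ m[%classic =
    (p.+1%:R / 2 ^+ m - p%:R / 2 ^+ m)%:E.
  by rewrite lebesgue_measure_itv /= lte_fin ltr_pM2r ?invr_gt0// ltr_nat leqnn.
apply: (etrans (congr1 fine E)).
by rewrite /= -mulrBl -natr1 addrAC subrr add0r mul1r.
Qed.

Lemma Rintegral_rademacherM m Q : dpoly m Q ->
  \int[mu]_(x in D) (rademacher m x * Q x) = 0.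
Proof.
move=> Qm; have m0 : (0 : R) < 2 ^+ m.+1 by rewrite exprn_gt0.
pose F x := rademacher m x * Q x.
have Fm : dpoly m.+1 F by apply: dpolyM; [exact: dpoly_rademacher|exact: dpolyS].
(* The right endpoint is [p / 2 ^ m]. Each induction step adds one dyadic interval, on which [Q] is
   constant and [rademacher m] has opposite signs on the two halves. *)
suff H p : \int[mu]_(x in `[0, p.*2%:R / 2 ^+ m.+1[) F x = 0.
  have := H (2 ^ m)%N; rewrite -muln2 -expnSr natrX divff ?lt0r_neq0//.
elim: p => [|p IH]; first by rewrite mul0r set_itvco0// Rintegral_set0.
have split a b c : a <= b -> b <= c ->
    \int[mu]_(x in `[a, c[) F x =
    \int[mu]_(x in `[a, b[) F x + \int[mu]_(x in `[b, c[) F x.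
  move=> ab bc; have U : `[a, c[%classic = `[a, b[ `|` `[b, c[ :> set R.
    by rewrite -itv_bndbnd_setU// bnd_simp.
  rewrite {1}U Rintegral_setU//.
    rewrite -U; apply: (dpoly_integrable Fm) => //.
    by rewrite lebesgue_measure_itv; case: ifP => _ /=; rewrite ltry.
  by apply/disj_set2P/disjoints_subset => x; rewrite /= !in_itv /=; lra.
have le a b : (a <= b)%N -> a%:R / 2 ^+ m.+1 <= b%:R / 2 ^+ m.+1 :> R.
  by move=> ab; rewrite ler_pM2r ?invr_gt0// ler_nat.
rewrite (split _ (p.*2%:R / 2 ^+ m.+1)) ?IH ?add0r; last 2 first.
- by rewrite divr_ge0// ltW.
- by apply: le; rewrite leq_double.
rewrite (split _ (p.*2.+1%:R / 2 ^+ m.+1)) ?le//.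
rewrite !(dyadic_itv_integral _ Fm) -mulrDl /F.
have rad q : rademacher m (q%:R / 2 ^+ m.+1) = (-1) ^+ q :> R.
  apply: rademacher_dyadic.
  by rewrite [_ * (_ / _)]mulrC divfK ?lt0r_neq0// lexx ltrDl ltr01.
rewrite !rad -signr_odd -[in X in _ + X * _]signr_odd /= odd_double expr0 expr1.
have half z : 2 ^+ m * (z / 2 ^+ m.+1) = z / 2 :> R.
  by rewrite exprS; field; rewrite expf_neq0.
rewrite (@dpoly_dyadic _ m Q _ (p.*2.+1%:R / 2 ^+ m.+1) p)//.
- by rewrite mul1r mulN1r subrr mul0r.
- by rewrite half -muln2 natrM; lra.
- by rewrite half -natr1 -muln2 natrM; lra.
Qed.

Lemma Rintegral_unit_cst (c : R) : \int[mu]_(x in D) c = c.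
Proof. by rewrite Rintegral_cst// (congr1 fine lebesgue_unit_itv) mulr1. Qed.

(** Induction on the number [m] of digits: a factor [rademacher m] present in both functions squares
    to [1], and one present in a single function makes the integral vanish. *)
Lemma walsh_orthonormal i k :
  \int[mu]_(x in D) (walsh i x * walsh k x) = (i == k)%:R.
Proof.
have [m im km] : exists2 m, (i < 2 ^ m)%N & (k < 2 ^ m)%N.
  exists (maxn i k); rewrite (leq_ltn_trans _ (ltn_expl _ (isT : 1 < 2)%N))//.
    exact: leq_maxl.
  exact: leq_maxr.
elim: m i k im km => [|m IH] i k.
  rewrite expn0 !ltnS !leqn0 => /eqP-> /eqP->.
  rewrite -[RHS]Rintegral_unit_cst; apply: eq_Rintegral => x _.
  by rewrite walsh0 mulr1.
have cmp n : (n < 2 ^ m.+1)%N ->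
    (n < 2 ^ m)%N \/ exists2 n', (n' < 2 ^ m)%N & n = (2 ^ m + n')%N.
  rewrite expnS mul2n -addnn => nm; have [?|mn] := ltnP n (2 ^ m); [by left|right].
  by exists (n - 2 ^ m)%N; rewrite ?subnKC// ltn_subLR.
have walshM a b : (a < 2 ^ m)%N -> (b < 2 ^ m)%N ->
    dpoly m (fun x : R => walsh a x * walsh b x).
  by move=> am bm; apply: dpolyM; exact: dpoly_walsh.
move=> /cmp[im|[i' im ->]] /cmp[km|[k' km ->]]; first exact: IH.
- have -> : (i == 2 ^ m + k')%N = false by rewrite ltn_eqF// (leq_trans im)// leq_addr.
  rewrite /= mulr0n.
  rewrite -(Rintegral_rademacherM (walshM _ _ im km)); apply: eq_Rintegral => x _.
  by rewrite walshD_pow2// mulrCA.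
- have -> : (2 ^ m + i' == k)%N = false by rewrite gtn_eqF// (leq_trans km)// leq_addr.
  rewrite /= mulr0n.
  rewrite -(Rintegral_rademacherM (walshM _ _ im km)); apply: eq_Rintegral => x _.
  by rewrite walshD_pow2// mulrA.
- rewrite eqn_add2l -IH//; apply: eq_Rintegral => x _.
  by rewrite !walshD_pow2// mulrACA rademacher_sq mul1r.
Qed.

Lemma walsh_sum_walsh n i x :
  walsh_sum n (walsh i) x = if (i < n)%N then walsh i x else 0 :> R.
Proof.
rewrite /walsh_sum /walsh_coef; under eq_bigr do rewrite walsh_orthonormal.
case: ifPn => [ni|]; last first.
  rewrite -leqNgt => ni; rewrite big1// => k _.
  by rewrite gtn_eqF ?mul0r// (leq_trans (ltn_ord k)).
rewrite (bigD1 (Ordinal ni)) //= eqxx mul1r big1 ?addr0// => k /negbTE ki.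
by rewrite -val_eqE /= in ki; rewrite eq_sym ki mul0r.
Qed.

Lemma walsh_sum_combination n (r : seq nat) (c : nat -> R) (idx : nat -> nat) x :
  walsh_sum n (fun y => \sum_(i <- r) c i * walsh (idx i) y) x =
  \sum_(i <- r) c i * (if (idx i < n)%N then walsh (idx i) x else 0).
Proof.
have walsh_int i : integrableD (walsh i).
  by apply: (@dpoly_integrableD i); apply: dpoly_walsh; exact: ltn_expl.
have walshZ_int a i : integrableD (fun y => a * walsh i y).
  apply: (@dpoly_integrableD i); apply: dpolyZ; apply: dpoly_walsh; exact: ltn_expl.
elim: r => [|a r IH].
  rewrite big_nil (_ : (fun=> _) = fun y => 0 * walsh 0 y).
    by rewrite walsh_sumZ// mul0r.
  by apply/funext => y; rewrite big_nil mul0r.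
rewrite big_cons -IH (_ : (fun=> _) = fun y => c a * walsh (idx a) y +
    \sum_(i <- r) c i * walsh (idx i) y); last by apply/funext => y; rewrite big_cons.
rewrite walsh_sumD ?walsh_sumZ ?walsh_sum_walsh//.
rewrite (_ : _ \o _ = fun y => (\sum_(i <- r) (c i * walsh (idx i) y)%:E)%E).
  by apply: integrable_sum => // i _; exact: walshZ_int.
by apply/funext => y; rewrite /= sumEFin.
Qed.

(** The frequencies of [walsh (a * 2 ^ m) * Q] lie in one block of length [2 ^ m], which is kept or
    killed as a whole when [n] is not interior to it. *)
Lemma walsh_sum_block m a n Q x : dpoly m Q ->
  ((a.+1 * 2 ^ m <= n)%N ->
    walsh_sum n (fun y => walsh (a * 2 ^ m) y * Q y) x = walsh (a * 2 ^ m) x * Q x) /\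
  ((n <= a * 2 ^ m)%N ->
    walsh_sum n (fun y => walsh (a * 2 ^ m) y * Q y) x = 0).
Proof.
move=> /dpoly_walsh_expansion[c QE].
have E y : walsh (a * 2 ^ m) y * Q y =
    \sum_(i <- index_iota 0 (2 ^ m)) c i * walsh (a * 2 ^ m + i) y.
  rewrite QE big_mkord mulr_sumr.
  by apply: eq_bigr => i _; rewrite walshD// mulrCA.
rewrite (funext E) E walsh_sum_combination; split=> an.
  apply: eq_big_seq => i; rewrite mem_index_iota /= => im.
  by rewrite ifT// (leq_trans _ an)// mulSn addnC ltn_add2r.
rewrite big1_seq// => i _; rewrite ifF ?mulr0//; apply/negbTE.
by rewrite -leqNgt (leq_trans an)// leq_addr.
Qed.

Lemma walsh_sum_dpoly m n Q x : dpoly m Q -> (2 ^ m <= n)%N -> walsh_sum n Q x = Q x.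
Proof.
move=> Qm mn; have [+ _] := walsh_sum_block 0 n x Qm.
rewrite mul1n mul0n walsh0 mul1r => <-//; congr (walsh_sum n _ x).
by apply/funext => y; rewrite walsh0 mul1r.
Qed.

Lemma walsh_sum_rademacherM m n Q x : dpoly m Q -> (n <= 2 ^ m)%N ->
  walsh_sum n (fun y => rademacher m y * Q y) x = 0.
Proof.
move=> Qm mn; have [_] := walsh_sum_block 1 n x Qm.
rewrite mul1n => <-//; congr (walsh_sum n _ x).
by apply/funext => y; rewrite walsh_pow2.
Qed.

(** Multiplication of [walsh n] by [rademacher m * Q] flips the digit [m] of [n] and alters only
    lower ones. If that digit is [1], all new frequencies are below [n] and are kept; if it is [0],
    they are above [n] and are killed. This turns the partial sum into a martingale transform. *)
Lemma walsh_sum_walsh_rademacherM m n Q x : dpoly m Q ->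
  walsh_sum n (fun y => walsh n y * (rademacher m y * Q y)) x =
  (eps m n)%:R * (walsh n x * (rademacher m x * Q x)).
Proof.
(* [lo] holds the digits of [n] below [m], and [b] those above [m]. *)
move=> Qm; pose lo := (n %% 2 ^ m)%N; pose b := ((n %/ 2 ^ m)./2)%N.
have lom : (lo < 2 ^ m)%N by rewrite ltn_mod expn_gt0.
have nE : n = ((eps m n + b.*2) * 2 ^ m + lo)%N.
  by rewrite /eps /b odd_double_half -divn_eq.
have Qlo : dpoly m (fun y => walsh lo y * Q y) by apply: dpolyM => //; exact: dpoly_walsh.
have odd_walsh y : walsh ((b.*2).+1 * 2 ^ m) y = rademacher m y * walsh (b.*2 * 2 ^ m) y.
  rewrite -muln2 mulSn addnC -mulnA -expnS walshD ?ltn_exp2l//.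
  by rewrite walsh_pow2 mulrC.
have walshnE y : walsh n y =
    rademacher m y ^+ eps m n * walsh (b.*2 * 2 ^ m) y * walsh lo y.
  rewrite {1}nE walshD//; congr (_ * _).
  by rewrite /eps; case: odd; rewrite /= ?expr0 ?mul1r// expr1 -odd_walsh.
have [keep _] := walsh_sum_block b.*2 n x Qlo.
have [_ kill] := walsh_sum_block b.*2.+1 n x Qlo.
have [e|e] : eps m n = 0%N \/ eps m n = 1%N by rewrite /eps; case: odd; [right|left].
  rewrite e mul0r -[RHS]kill; last by rewrite nE e add0n mulSn addnC leq_add2r ltnW.
  congr (walsh_sum n _ x); apply/funext => y.
  by rewrite walshnE e odd_walsh expr0; ring.
have E y : walsh n y * (rademacher m y * Q y) =
    walsh (b.*2 * 2 ^ m) y * (walsh lo y * Q y).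
  rewrite walshnE e expr1; case: (rademacher_or m y) => ->; ring.
by rewrite (funext E) E e mul1r keep// nE e add1n leq_addr.
Qed.

Lemma walsh_sum_self n x : walsh_sum n (walsh n) x = 0 :> R.
Proof. by rewrite walsh_sum_walsh ltnn. Qed.

End WalshIntegrals.

(** * A sign function whose martingale transform is large *)

Section SignFunction.
Variables (R : realType) (n : nat).
Implicit Types (rho : nat -> R).

Let N := (trunc_log 2 n).+1.

(* [signf rho] is [1 - 2 * eps j n] for the first [j < N] such that [rho j = -1],
   and [1] if there is none. It is written as the sum of its martingale
   differences, [tail_mean j] being its mean over the sequences of signs [rho]
   that start with [j] times [1]. *)
Fixpoint tail_mean_rec d : R :=
  if d is d'.+1 then (1 - 2 * (eps (N - d) n)%:R + tail_mean_rec d') / 2 else 1.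

Definition tail_mean j : R := tail_mean_rec (N - j).

(** For a sequence of signs this is the indicator of the event that the first [j] of them are
    [1]. *)
Definition cylinder rho j : R := \prod_(l < j) ((1 + rho l) / 2).

Definition signf rho : R :=
  tail_mean 0 + \sum_(j < N) (tail_mean j.+1 - tail_mean j) * (rho j * cylinder rho j).

Lemma cylinderS rho j : cylinder rho j.+1 = cylinder rho j * ((1 + rho j) / 2).
Proof. by rewrite /cylinder big_ord_recr. Qed.

Lemma tail_mean_last : tail_mean N = 1.
Proof. by rewrite /tail_mean subnn. Qed.

Lemma tail_meanS j : (j < N)%N ->
  tail_mean j = (1 - 2 * (eps j n)%:R + tail_mean j.+1) / 2.
Proof.
move=> jN; rewrite /tail_mean -(subnSK jN) /=.
by rewrite subnSK// subKn// ltnW.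
Qed.

(** As long as the signs are [1], the sum telescopes to [tail_mean k]. At the first [rho k = -1] it
    becomes [2 * tail_mean k - tail_mean k.+1], which is [1 - 2 * eps k n] by [tail_meanS], and it
    stays there because the later cylinders vanish. *)
Lemma signf_partial rho k : (forall j, rho j = 1 \/ rho j = -1) -> (k <= N)%N ->
  let s := tail_mean 0 +
    \sum_(j < k) (tail_mean j.+1 - tail_mean j) * (rho j * cylinder rho j) in
  (cylinder rho k = 1 /\ s = tail_mean k) \/
  (cylinder rho k = 0 /\ (s = 1 \/ s = -1)).
Proof.
move=> rho1; elim: k => [_|k IH kN] /=.
  by left; rewrite /cylinder !big_ord0 addr0.
have := IH (ltnW kN); rewrite /= cylinderS big_ord_recr /= addrA.
move=> [[-> ->]|[-> s1]]; last first.
  by right; rewrite mulr0 mulr0 addr0 mul0r.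
case: (rho1 k) => ->; [left|right]; split; try by field.
by rewrite (tail_meanS kN); case: eps (epsE01 k n) => [|[|?]] // _; [left|right]; field.
Qed.

Lemma signf_pm rho : (forall j, rho j = 1 \/ rho j = -1) ->
  signf rho = 1 \/ signf rho = -1.
Proof.
move=> rho1; have [[_]|[_]] := signf_partial rho1 (leqnn N); last by [].
by rewrite tail_mean_last; left.
Qed.

Lemma cylinder1 rho k : (forall j, (j < k)%N -> rho j = 1) -> cylinder rho k = 1.
Proof.
move=> rho1; rewrite /cylinder big1// => j _; rewrite rho1//.
by rewrite -[1 + 1]/2%:R divff.
Qed.

Lemma signf1 rho : (forall j, (j < N)%N -> rho j = 1) -> signf rho = 1.
Proof.
move=> rho1; rewrite /signf -[RHS]tail_mean_last.
rewrite (eq_bigr (fun j : 'I_N => tail_mean j.+1 - tail_mean j)) => [|j _].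
  rewrite -(big_mkord xpredT (fun j => tail_mean j.+1 - tail_mean j)).
  by rewrite telescope_sumr// addrC subrK.
rewrite rho1// cylinder1 ?mulr1// => l lj; apply: rho1.
by rewrite (ltn_trans lj).
Qed.

(** The variation counts every run of digits [1] twice, at its two ends. Where such a run ends, at a
    digit [1] followed by [0], the term is [(1 + tail_mean j.+1) / 2 >= 1 / 2], and no term is
    negative. *)
Lemma variation_lower_bound : (0 < n)%N ->
  (bin_variation n)%:R / 4 <=
  \sum_(j < N) (eps j n)%:R * (tail_mean j.+1 - tail_mean j) :> R.
Proof.
move=> n0.
pose W j := \sum_(j <= i < N) (eps i n)%:R * (tail_mean i.+1 - tail_mean i).
pose V j : nat := (\sum_(j <= i < N) `|eps i.+1 n - eps i n|)%N.
(* Downward induction from the top digit. The extra [eps j n] records that an open run of ones has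
   already paid for the change at its lower end. *)
have H d : (d <= N)%N -> let j := (N - d)%N in
  [/\ ((V j)%:R + (eps j n)%:R) / 4 <= W j,
      eps j n = 0%N -> 0 <= tail_mean j & -1 <= tail_mean j].
  elim: d => [_|d IH dN] /=.
    rewrite subn0 /W /V !big_geq// (eps_small (trunc_log_ltn _ _))// tail_mean_last.
    rewrite !mulr0n; split => [|_|]; first by rewrite addr0 mul0r.
      exact: ler01.
    by apply: (le_trans _ ler01); rewrite lerN10.
  have := IH (ltnW dN); rewrite /= -subSS.
  set j := (N - d.+1)%N; have jN : (j < N)%N by rewrite /j ltn_subrL.
  rewrite (_ : (N.+1 - d.+1)%N = j.+1); last by rewrite /j subSn.
  move=> [VW e0 a1]; rewrite /W /V !(big_ltn jN) -/(W _) -/(V _) natrD.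
  case: (eps j n) (epsE01 j n) (tail_meanS jN) => [|[|//]] _;
    case: (eps j.+1 n) (epsE01 j.+1 n) VW e0 => [|[|//]] _ VW e0 aj;
    rewrite /= ?mulr0n ?mulr1n in VW aj *.
  - by have := e0 erefl; split => [|_|]; lra.
  - by split => [|_|]; lra.
  - by have := e0 erefl; split => //; lra.
  - by split => //; lra.
have [] := H N (leqnn N); rewrite subnn /W /V !big_mkord => VW _ _.
by rewrite bin_variationE natrD addrC.
Qed.

End SignFunction.

(** * Riesz products along the sequence and their partial sums *)

Section RieszBlock.
Variables (R : realType) (nk : nat -> nat) (nkP : nested_spectrums nk) (nu : nat).
Implicit Types (x t : R) (i j k l : nat).

Let N := (top_digit nk nu).+1.
Let idx i := (nu.+1 + i)%N.

(** The digits of [i] encode signs, so that [i < 2 ^ N] runs over all sign patterns of length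
    [N]. *)
Definition pattern i j : R := (-1) ^+ eps j i.

Definition block_sign i t : R := signf (nk nu) (fun j => pattern i j * rademacher j t).

(** The first [2 ^ N] factors already use every pattern; further ones repeat patterns and make the
    product higher on a smaller set. *)
Definition riesz l t : R :=
  \prod_(i < l) (1 + block_sign i t * walsh (nk (idx i)) t).

Lemma rieszS l t :
  riesz l.+1 t = riesz l t + walsh (nk (idx l)) t * (riesz l t * block_sign l t).
Proof. by rewrite /riesz big_ord_recr /=; ring. Qed.

Lemma pattern_pm i j t :
  pattern i j * rademacher j t = 1 \/ pattern i j * rademacher j t = -1.
Proof.
rewrite /pattern; case: (rademacher_or j t) => ->; case: eps (epsE01 j i) => [|[|//]] _;
  rewrite ?expr0 ?expr1; [left|right|right|left]; ring.
Qed.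

Lemma block_sign_pm i t : block_sign i t = 1 \/ block_sign i t = -1.
Proof. by apply: signf_pm => j; exact: pattern_pm. Qed.

Lemma dpoly_cylinder i j m : (j <= m)%N ->
  dpoly m (fun t => cylinder (fun j => pattern i j * rademacher j t) j).
Proof.
move=> jm; apply: dpoly_prod => l _; apply: dpolyM; last exact: dpoly_cst.
apply: dpolyD; first exact: dpoly_cst.
by apply: dpolyZ; apply: dpoly_rademacher; exact: leq_trans jm.
Qed.

Lemma dpoly_block_sign i : dpoly N (block_sign i).
Proof.
apply: dpolyD; first exact: dpoly_cst.
apply: dpoly_sum => j _; apply: dpolyZ; apply: dpolyM.
  by apply: dpolyZ; exact: dpoly_rademacher.
by apply: dpoly_cylinder; exact: ltnW.
Qed.

Lemma idx_top l : (N <= top_digit nk (idx l))%N.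
Proof. by apply: top_ltn => //; rewrite /idx addSn ltnS leq_addr. Qed.

Lemma dpoly_riesz l : dpoly (top_digit nk (nu + l)).+1 (riesz l).
Proof.
elim: l => [|l IH].
  by apply: dpoly_ext (dpoly_cst _ 1) => t; rewrite /riesz big_ord0.
have le : ((top_digit nk (nu + l)).+1 <= (top_digit nk (nu + l.+1)))%N.
  by apply: top_ltn => //; rewrite addnS.
have idxE : idx l = (nu + l.+1)%N by rewrite /idx addSnnS.
apply: dpoly_ext (fun t => esym (rieszS l t)) _.
apply: dpolyD; first by apply: dpoly_leq IH; exact: leqW.
apply: dpolyM; first by rewrite idxE; apply: dpoly_walsh; exact: ltn_topS.
apply: dpolyM; first by apply: dpoly_leq IH; exact: leqW.
by apply: dpoly_leq (dpoly_block_sign l); rewrite -idxE leqW// idx_top.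
Qed.

Lemma dpoly_riesz_sign l :
  dpoly (top_digit nk (idx l)) (fun t => riesz l t * block_sign l t).
Proof.
apply: dpolyM; last exact: dpoly_leq (idx_top l) (dpoly_block_sign l).
by apply: dpoly_leq (dpoly_riesz l); rewrite /idx addSn; apply: top_ltn.
Qed.

Lemma walsh_top k : exists2 i, (i < 2 ^ top_digit nk k)%N &
  forall t : R, walsh (nk k) t = rademacher (top_digit nk k) t * walsh i t.
Proof.
have le := leq_top nkP k; exists (nk k - 2 ^ top_digit nk k)%N.
  by rewrite ltn_subLR// addnn -mul2n -expnS ltn_topS.
move=> t; rewrite -{1}(subnKC le) walshD_pow2//.
by rewrite ltn_subLR// addnn -mul2n -expnS ltn_topS.
Qed.

(** The factor [rademacher] at the top digit, absent from everything else, makes the increment of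
    mean zero and invisible to partial sums of order at most [2 ^ top_digit nk (idx l)]. *)
Lemma riesz_increment l : exists2 Q : R -> R, dpoly (top_digit nk (idx l)) Q &
  forall t, walsh (nk (idx l)) t * (riesz l t * block_sign l t) =
    rademacher (top_digit nk (idx l)) t * Q t.
Proof.
have [i it E] := walsh_top (idx l).
exists (fun t => walsh i t * (riesz l t * block_sign l t)).
  by apply: dpolyM; [exact: dpoly_walsh|exact: dpoly_riesz_sign].
by move=> t; rewrite E -mulrA.
Qed.

Lemma riesz_values l t : riesz l t = 0 \/ riesz l t = 2 ^+ l.
Proof.
elim: l => [|l IH]; first by right; rewrite /riesz big_ord0.
case: IH => IH.
  by left; rewrite rieszS IH; ring.
rewrite rieszS IH exprS.
by case: (walsh_pm (nk (idx l)) t) => ->; case: (block_sign_pm l t) => ->;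
  [right|left|left|right]; ring.
Qed.

Lemma riesz_ge0 l t : 0 <= riesz l t.
Proof. by case: (riesz_values l t) => ->//; rewrite exprn_ge0. Qed.

Lemma Rintegral_riesz l : \int[lebesgue_measure]_(t in @unit_itv R) riesz l t = 1.
Proof.
elim: l => [|l IH].
  rewrite -[RHS]Rintegral_unit_cst; apply: eq_Rintegral => t _.
  by rewrite /riesz big_ord0.
have [Q Qm QE] := riesz_increment l.
under eq_Rintegral do rewrite rieszS QE.
have rQ : dpoly (top_digit nk (idx l)).+1
    (fun t => rademacher (top_digit nk (idx l)) t * Q t).
  by apply: dpolyM; [exact: dpoly_rademacher|exact: dpolyS].
rewrite RintegralD ?IH ?Rintegral_rademacherM ?addr0//.
- exact: measurable_unit_itv.
- exact: dpoly_integrableD (dpoly_riesz l).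
- exact: dpoly_integrableD rQ.
Qed.

Lemma walsh_sum_dpolyD n m (P Q : R -> R) x : dpoly m P -> dpoly m Q ->
  walsh_sum n (fun y => P y + Q y) x = walsh_sum n P x + walsh_sum n Q x.
Proof.
move=> Pm Qm; apply: walsh_sumD; first exact: dpoly_integrableD Pm.
exact: dpoly_integrableD Qm.
Qed.

Lemma walsh_sum_dpolyZ n m a (Q : R -> R) x : dpoly m Q ->
  walsh_sum n (fun y => a * Q y) x = a * walsh_sum n Q x.
Proof. by move=> Qm; apply: walsh_sumZ; exact: dpoly_integrableD Qm. Qed.

Lemma walsh_sum_dpoly_sum n m p (F : nat -> R -> R) x :
  (forall i, (i < p)%N -> dpoly m (F i)) ->
  walsh_sum n (fun y => \sum_(i < p) F i y) x = \sum_(i < p) walsh_sum n (F i) x.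
Proof.
elim: p => [_|p IH Fm].
  rewrite big_ord0 (_ : (fun=> _) = fun y => 0 * walsh 0 y); last first.
    by apply/funext => y; rewrite big_ord0 mul0r.
  by rewrite (@walsh_sum_dpolyZ _ 0) ?mul0r//; exact: dpoly_walsh.
rewrite big_ord_recr /= -IH; last by move=> i ip; apply: Fm; exact: ltnW.
rewrite -(@walsh_sum_dpolyD _ m); last 2 first.
- by apply: dpoly_sum => i _; apply: Fm; exact: leqW (ltn_ord i).
- exact: Fm.
by congr (walsh_sum n _ x); apply/funext => y; rewrite big_ord_recr.
Qed.

(** The increments after [i.+1] only have frequencies from [2 ^ top_digit nk (idx l)] on for some
    [l > i], and these exceed [nk (idx i)]. *)
Lemma walsh_sum_riesz_trunc i l x : (i < l)%N ->
  walsh_sum (nk (idx i)) (riesz l) x = walsh_sum (nk (idx i)) (riesz i.+1) x.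
Proof.
elim: l => // l IH; rewrite ltnS leq_eqVlt => /orP[/eqP->//|il].
rewrite -IH// (funext (rieszS l)); have [Q Qm QE] := riesz_increment l.
rewrite (_ : (fun t => _) =
    fun t => riesz l t + rademacher (top_digit nk (idx l)) t * Q t); last first.
  by apply/funext => t; rewrite QE.
have tl : (top_digit nk (nu + l) < top_digit nk (idx l))%N.
  by apply: top_ltn => //; rewrite /idx addSn.
rewrite (@walsh_sum_dpolyD _ (top_digit nk (idx l)).+1).
- rewrite walsh_sum_rademacherM ?addr0//.
  rewrite (leq_trans (ltnW (ltn_topS nk _)))// leq_exp2l//.
  by apply: top_ltn => //; rewrite /idx ltn_add2l.
- by apply: dpoly_leq (dpoly_riesz l); exact: leqW.
- by apply: dpolyM; [exact: dpoly_rademacher|exact: dpolyS].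
Qed.

Lemma eps_top_idx l i : (l <= i)%N -> eps (top_digit nk (idx l)) (nk (idx i)) = 1%N.
Proof. by move=> li; apply: nested_eps_top => //; rewrite leq_add2l. Qed.

(* Every frequency of [walsh (nk (idx i)) * block_sign i * (riesz l - 1)] is
   below [nk (idx i)]: its highest modified digit was a digit [1] of [nk (idx i)]. *)
Lemma walsh_sum_riesz_sub1 i l x : (l <= i)%N ->
  let F t := walsh (nk (idx i)) t * ((riesz l t - 1) * block_sign i t) in
  walsh_sum (nk (idx i)) F x = F x.
Proof.
move=> + F; rewrite {}/F; elim: l => [_|l IH li].
  have E t : walsh (nk (idx i)) t * ((riesz 0 t - 1) * block_sign i t) = 0 * walsh 0 t.
    by rewrite /riesz big_ord0; ring.
  by rewrite (funext E) E (@walsh_sum_dpolyZ _ 0) ?mul0r//; exact: dpoly_walsh.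
have [Q Qm QE] := riesz_increment l.
have Qsm : dpoly (top_digit nk (idx l)) (fun t => Q t * block_sign i t).
  by apply: dpolyM => //; apply: dpoly_leq (idx_top l) (dpoly_block_sign i).
have E t : walsh (nk (idx i)) t * ((riesz l.+1 t - 1) * block_sign i t) =
    walsh (nk (idx i)) t * ((riesz l t - 1) * block_sign i t) +
    walsh (nk (idx i)) t * (rademacher (top_digit nk (idx l)) t * (Q t * block_sign i t)).
  by rewrite rieszS QE; ring.
pose m := (top_digit nk (idx i)).+1.
have topli : (top_digit nk (idx l) < m)%N by rewrite ltnS top_leq// leq_add2l ltnW.
have wm : dpoly m (walsh (nk (idx i)) : R -> R) by apply: dpoly_walsh; exact: ltn_topS.
rewrite (funext E) E (@walsh_sum_dpolyD _ m).
- rewrite IH ?(ltnW li)// walsh_sum_walsh_rademacherM//.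
  by rewrite eps_top_idx ?(ltnW li)// mul1r.
- apply: dpolyM => //; apply: dpolyM.
    apply: dpolyD; last exact: dpoly_cst.
    apply: dpoly_leq (dpoly_riesz l); rewrite (leq_trans _ topli)//.
    by apply: leqW; apply: top_ltn => //; rewrite /idx addSn.
  by apply: dpoly_leq (dpoly_block_sign i); rewrite leqW// idx_top.
- apply: dpolyM => //; apply: dpolyM; first exact: dpoly_rademacher.
  by apply: dpoly_leq Qsm; exact: ltnW.
Qed.

(** The martingale transform [T] of [block_sign i]: its differences at the levels in the spectrum of
    [nk nu]. *)
Definition transform i x : R := \sum_(j < N) (eps j (nk nu))%:R *
  ((tail_mean R (nk nu) j.+1 - tail_mean R (nk nu) j) *
   (pattern i j * rademacher j x * cylinder (fun j => pattern i j * rademacher j x) j)).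

(** The mean of [block_sign i] contributes a multiple of [walsh n], which the sum of order [n]
    omits. Each difference is kept or killed according to a digit of [n], and by nesting the digits
    below [N] are those of [nk nu]. *)
Lemma walsh_sum_block_sign i x :
  walsh_sum (nk (idx i)) (fun t => walsh (nk (idx i)) t * block_sign i t) x =
  walsh (nk (idx i)) x * transform i x.
Proof.
set n := nk (idx i); pose a := tail_mean R (nk nu).
pose G j t := (a j.+1 - a j) * pattern i j *
  cylinder (fun j => pattern i j * rademacher j t) j.
have Gm j : dpoly j (G j) by apply: dpolyZ; exact: dpoly_cylinder.
have E t : walsh n t * block_sign i t =
    a 0 * walsh n t + \sum_(j < N) walsh n t * (rademacher j t * G j t).
  rewrite /block_sign /signf mulrDr mulr_sumr; congr (_ + _); first by rewrite mulrC.
  by apply: eq_bigr => j _; rewrite /G /a; ring.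
pose m := (top_digit nk (idx i)).+1.
have wm : dpoly m (walsh n : R -> R) by apply: dpoly_walsh; exact: ltn_topS.
have Fm j : (j < N)%N -> dpoly m (fun t => walsh n t * (rademacher j t * G j t)).
  move=> jN; apply: dpolyM => //; have jm : (j < m)%N.
    by rewrite (leq_trans jN)// leqW// idx_top.
  by apply: dpolyM; [exact: dpoly_rademacher|exact: dpoly_leq (ltnW jm) (Gm j)].
rewrite (funext E) (@walsh_sum_dpolyD _ m).
- rewrite (walsh_sum_dpolyZ _ _ _ wm) walsh_sum_self mulr0 add0r.
  rewrite (walsh_sum_dpoly_sum _ _ Fm) mulr_sumr; apply: eq_bigr => j _.
  rewrite walsh_sum_walsh_rademacherM// (nested_eps_leq nkP (k := nu))//.
    by rewrite /G /a; ring.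
    by rewrite /idx addSn leqW// leq_addr.
  by rewrite -ltnS ltn_ord.
- exact: (dpolyZ (a 0) wm).
- by apply: dpoly_sum => j _; apply: Fm.
Qed.

(** Of [riesz i.+1], only the term [walsh n * block_sign i] is changed by the partial sum. Writing
    the result around [riesz i.+1] makes its sign available. *)
Lemma walsh_sum_riesz i l x : (i < l)%N ->
  walsh_sum (nk (idx i)) (riesz l) x = riesz i.+1 x +
    walsh (nk (idx i)) x * (transform i x - block_sign i x).
Proof.
move=> il; rewrite (walsh_sum_riesz_trunc _ il); set n := nk (idx i).
have E t : riesz i.+1 t = riesz i t +
    (walsh n t * ((riesz i t - 1) * block_sign i t) + walsh n t * block_sign i t).
  by rewrite rieszS /n; ring.
have tl : (top_digit nk (nu + i) < top_digit nk (idx i))%N.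
  by apply: top_ltn => //; rewrite /idx addSn.
pose m := (top_digit nk (idx i)).+1.
have wm : dpoly m (walsh n : R -> R) by apply: dpoly_walsh; exact: ltn_topS.
have rm : dpoly m (riesz i) by apply: dpoly_leq (dpoly_riesz i); exact: leqW.
have sm : dpoly m (block_sign i).
  by apply: dpoly_leq (dpoly_block_sign i); rewrite leqW// idx_top.
have r1m : dpoly m (fun t => walsh n t * ((riesz i t - 1) * block_sign i t)).
  apply: dpolyM => //; apply: dpolyM => //.
  by apply: dpolyD => //; exact: dpoly_cst.
have wsm : dpoly m (fun t => walsh n t * block_sign i t) by exact: dpolyM.
rewrite (funext E) (walsh_sum_dpolyD _ _ rm (dpolyD r1m wsm)).
rewrite (walsh_sum_dpolyD _ _ r1m wsm).
rewrite walsh_sum_riesz_sub1// walsh_sum_block_sign /=.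
rewrite (walsh_sum_dpoly _ (dpoly_riesz i)); first ring.
by rewrite (leq_trans _ (leq_top nkP _))// leq_exp2l.
Qed.

Lemma pattern_exists x m : exists2 i, (i < 2 ^ m)%N &
  forall j, (j < m)%N -> pattern i j * rademacher j x = 1.
Proof.
elim: m => [|m [i im E]]; first by exists 0%N.
pose b : nat := rademacher m x != 1.
exists (b * 2 ^ m + i)%N => [|j].
  rewrite expnS mul2n -addnn -addnS leq_add//.
  by rewrite /b; case: eqP => //=; rewrite mul1n.
rewrite ltnS leq_eqVlt => /orP[/eqP->|jm].
  rewrite /pattern eps_addn_high// /eps mulnK ?expn_gt0// /b.
  case: eqP => [->|]; first by rewrite expr0 mulr1.
  by case: (rademacher_or m x) => -> //=; rewrite expr1 mulrNN mulr1.
by rewrite /pattern eps_addn_low//; exact: E.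
Qed.

Lemma walsh_sum_riesz_lower_bound l x : (2 ^ N <= l)%N ->
  exists2 k, (nu < k <= nu + l)%N &
    (bin_variation (nk nu))%:R / 4 - 1 <= `|walsh_sum (nk k) (riesz l) x|.
Proof.
move=> Nl; have [i iN ix] := pattern_exists x N.
have il := leq_trans iN Nl.
exists (idx i); first by rewrite /idx addSn ltnS leq_addr /= ltn_add2l.
rewrite walsh_sum_riesz//.
have s1 : block_sign i x = 1 by apply: signf1 => j jN; exact: ix.
have tV : (bin_variation (nk nu))%:R / 4 <= transform i x.
  have nu0 : (0 < nk nu)%N by case: nkP.
  rewrite (le_trans (variation_lower_bound R nu0))// le_eqVlt; apply/orP; left; apply/eqP.
  apply: eq_bigr => j _; rewrite ix// cylinder1 ?mulr1// => k kj.
  by apply: ix; exact: ltn_trans (ltn_ord j).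
have := riesz_ge0 i x; rewrite s1 rieszS s1.
(* If the Walsh function is [1], the nonnegative product helps. If it is [-1], then
   [riesz i.+1 x = 0] since [block_sign i x = 1], so nothing cancels the negative term. *)
case: (walsh_pm (nk (idx i)) x) => -> r0.
  by rewrite ler_normr; apply/orP; left; lra.
by rewrite ler_normr; apply/orP; right; lra.
Qed.

End RieszBlock.

(** * Choice of the parameters of the successive blocks *)

Section Choice.
Variables (R : realType) (nk : nat -> nat) (nkP : nested_spectrums nk).

Local Notation V k := (bin_variation (nk k)).

Lemma unbounded_variation_after :
  ereal_sup (range (fun k => ((V k)%:R : R)%:E)) = +oo%E ->
  forall K A, exists2 k, (K <= k)%N & (A <= V k)%N.
Proof.
move=> sup_oo K A; apply: contrapT => no.
(* The sum bounds the variations of the indices below [K], and [A] would bound the others. *)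
pose B := (A + \sum_(i < K) V i)%N.
have : (ereal_sup (range (fun k => ((V k)%:R : R)%:E)) <= (B%:R : R)%:E)%E.
  apply: ge_ereal_sup => _ [k _ <-]; rewrite lee_fin ler_nat.
  have [kK|Kk] := ltnP k K.
    by rewrite /B (bigD1 (Ordinal kK)) //= addnCA leq_addr.
  rewrite (leq_trans _ (leq_addr _ _))// leqNgt; apply/negP => Ak.
  by apply: no; exists k => //; exact: ltnW.
by rewrite sup_oo leye_eq.
Qed.

Lemma leq_nested k : (k <= nk k)%N.
Proof. by elim: k => // k IH; rewrite (leq_ltn_trans IH)// nested_ltn. Qed.

Lemma littleo_at_nodes (phi : R -> R) :
  (forall u : R, phi u =o_(u \near pinfty_nbhs R) phi_seq nk u) ->
  forall delta : R, 0 < delta -> exists K, forall k, (K <= k)%N ->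
    phi (2 ^+ (2 * nk k)) <= delta * (2 ^+ (2 * nk k) * (V k)%:R).
Proof.
move=> phi_o delta delta0.
have /eqoP/(_ _ delta0)[M [_ HM]] := funext phi_o.
have [K KM] : exists K : nat, M < K%:R.
  exists (Num.truncn M).+1; exact: truncnS_gt.
exists K => k Kk; have nk_incr i : (nk i < nk i.+1)%N by exact: nested_ltn.
rewrite -phi_seq_pow//; apply: le_trans (ler_norm _) _.
rewrite -[X in _ <= _ * X]ger0_norm; last first.
  by rewrite phi_seq_pow// mulr_ge0// exprn_ge0.
apply: HM; rewrite (lt_le_trans KM)// -natrX ler_nat (leq_trans Kk)//.
rewrite (leq_trans (leq_nested k))// ltnW// (ltn_trans (ltn_expl _ (isT : 1 < 2)%N))//.
by rewrite ltn_exp2l// ltn_Pmull//; case: nkP.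
Qed.

(** For [p = (nu, s)], [2 * nk nu] factors suffice for all sign patterns, and the [s] others
    compensate the normalization: the height [2 ^ (2 * nk nu) / 2] does not depend on [s]. *)
Definition block_length (p : nat * nat) : nat := (2 * nk p.1 + p.2)%N.

Definition block_end (p : nat * nat) : nat := (p.1 + block_length p)%N.

(* A pair [(nu, s)] stands for the block at [nu] of mean [2 ^ - s.+1]. The last
   three conditions make its partial sums exceed the sum of the earlier blocks,
   its effect on the partial sums used for the earlier blocks negligible, and
   its [phi]-integral summable. *)
Definition good_block (phi : R -> R) (q : nat) (p p' : nat * nat) : Prop :=
  [/\ (block_end p <= p'.1)%N,
      2 ^+ (2 * nk p.1) + q%:R <= (2 ^+ p'.2.+1)^-1 * ((V p'.1)%:R / 4 - 1) :> R,
      (nk (block_end p))%:R * (2 ^+ p'.2.+1)^-1 <= 1 / (2 ^ q.+1)%:R :> R &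
      phi (2 ^+ (2 * nk p'.1)) / (2 ^+ (2 * nk p'.1) * 2 ^+ p'.2) <= 1 / (2 ^ q.+1)%:R].

Lemma good_block_exists (phi : R -> R) q p :
  ereal_sup (range (fun k => ((V k)%:R : R)%:E)) = +oo%E ->
  (forall u : R, phi u =o_(u \near pinfty_nbhs R) phi_seq nk u) ->
  exists p', good_block phi q p p'.
Proof.
move=> sup_oo phi_o.
(* [C] is the size that the new partial sums must exceed, and [B] the largest order used by the
   earlier block. *)
pose C := (2 ^ (2 * nk p.1) + q)%N; pose B := nk (block_end p).
have C0 : (0 < C)%N by rewrite addn_gt0 expn_gt0.
have B0 : (0 < B)%N by case: nkP => nk_gt0 _ _; exact: nk_gt0.
pose tau : R := 1 / (2 ^ q.+1)%:R.
have tau0 : 0 < tau by rewrite divr_gt0// ltr0n expn_gt0.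
have C32 : (0 : R) < 32 * C%:R by rewrite mulr_gt0// ltr0n.
have [K KP] := littleo_at_nodes phi_o (divr_gt0 tau0 C32).
have [k Kk Ak] := unbounded_variation_after sup_oo
  (maxn K (block_end p)) (16 * C * (B * 2 ^ q.+1)).
move: Kk; rewrite geq_max => /andP[/KP phik pk].
have C16 : (0 < 16 * C)%N by rewrite muln_gt0.
have VC : (16 * C <= V k)%N.
  by rewrite (leq_trans _ Ak)// leq_pmulr// muln_gt0 B0 expn_gt0.
(* Thus [2 ^ s * 16 * C <= V k < 2 ^ s.+1 * 16 * C]. The lower bound on [V k] gives the size of the
   partial sums; the upper one gives [B * 2 ^ q.+1 < 2 ^ s.+1], by the choice of [k], and turns
   [phi = o(phi_seq nk)] with factor [tau / (32 * C)] into the last condition. *)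
pose s := trunc_log 2 (V k %/ (16 * C)).
have quo0 : (0 < V k %/ (16 * C))%N by rewrite divn_gt0.
have /andP[] := @trunc_log_bounds 2 (V k %/ (16 * C)) isT quo0.
rewrite -/s leq_divRL// ltn_divLR// => sV Vs.
have sV' : 2 ^+ s * (16 * C%:R) <= (V k)%:R :> R by rewrite -natrX -!natrM ler_nat.
have Vs' : (V k)%:R <= 2 ^+ s.+1 * (16 * C%:R) :> R.
  by rewrite -natrX -!natrM ler_nat ltnW.
have s0 : (0 : R) < 2 ^+ s by rewrite exprn_gt0.
have sS : 2 ^+ s.+1 = 2 * 2 ^+ s :> R by rewrite exprS.
exists (k, s); split => //=.
- rewrite mulrC ler_pdivlMr ?exprn_gt0// -natrX -natrD -/C.
  (* This absorbs the [- 1]: [2 ^ s.+1 * C <= V k / 8 <= V k / 4 - 1]. *)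
  have V8 : 8 <= (V k)%:R :> R.
    by rewrite ler_nat (leq_trans _ VC)// (@leq_trans (16 * 1))// leq_mul2l C0.
  by rewrite sS; nra.
- rewrite -/B ler_pdivrMr ?exprn_gt0// mulrAC mul1r ler_pdivlMr ?ltr0n ?expn_gt0//.
  rewrite -natrX -natrM ler_nat -(leq_pmul2l C16) (leq_trans Ak)// ltnW//.
  by rewrite mulnC.
- rewrite -/tau ler_pdivrMr ?mulr_gt0 ?exprn_gt0//.
  apply: (le_trans phik); rewrite mulrCA [leRHS]mulrCA ler_pM2l ?exprn_gt0//.
  rewrite -mulrA ler_pM2l// mulrC ler_pdivrMr// (le_trans Vs')// sS.
  by rewrite le_eqVlt; apply/orP; left; apply/eqP; ring.
Qed.

End Choice.

(** * The sum of the blocks: its [phi]-integral and its partial sums *)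

Section DivergentFunction.
Variables (R : realType) (nk : nat -> nat) (nkP : nested_spectrums nk).
Variables (phi : R -> R) (phi_nondecr : nondecreasing_nonneg phi).
Variables (u : nat -> nat * nat).
Hypothesis uP : forall q, good_block nk phi q (u q) (u q.+1).
Implicit Types (x t : R) (p q k : nat).

Local Notation mu := (@lebesgue_measure R).
Local Notation D := (@unit_itv R).
Let measurableD : measurable D := @measurable_unit_itv R.
Local Hint Resolve measurableD : core.

Let nu q := (u q).1.
Let height q : R := 2 ^+ (2 * nk (nu q)).
Let mass q : R := (2 ^+ (u q.+1).2.+1)^-1.

Let nk_gt0 k : (0 < nk k)%N. Proof. by case: nkP. Qed.

Let phi_ge0 v : 0 <= v -> 0 <= phi v. Proof. by case: phi_nondecr => + _; apply. Qed.

Let phi_le v w : 0 <= v -> v <= w -> phi v <= phi w.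
Proof. by case: phi_nondecr => _; apply. Qed.

(** The index is shifted: block [q] comes from the pair [u q.+1], and [u 0] is only a starting value
    that carries no block. *)
Definition block q t : R := mass q * riesz nk (nu q.+1) (block_length nk (u q.+1)) t.

Definition partial p t : R := \sum_(q < p) block q t.

Definition total t : R := fine (\sum_(q <oo) (block q t)%:E)%E.

Let mass_gt0 q : 0 < mass q.
Proof. by rewrite invr_gt0 exprn_gt0. Qed.

Let height_gt0 q : 0 < height q.
Proof. by rewrite exprn_gt0. Qed.

Lemma nu_ltn q : (nu q < nu q.+1)%N.
Proof.
have [+ _ _ _] := uP q; apply: leq_trans.
rewrite /block_end /block_length -/(nu q) -addn1 leq_add2l.
by rewrite ltn_addr// muln_gt0 nk_gt0.
Qed.

Lemma double_height q : 2 * height q <= height q.+1.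
Proof.
rewrite /height -exprS -!natrX ler_nat leq_exp2l// ltn_mul2l /=.
by apply: nested_ltn => //; exact: nu_ltn.
Qed.

Lemma block_values q t : block q t = 0 \/ block q t = height q.+1 / 2.
Proof.
rewrite /block; case: (riesz_values nk (nu q.+1) (block_length nk (u q.+1)) t) => ->.
  by left; rewrite mulr0.
right; rewrite /mass /height /block_length exprD exprS; field.
by rewrite expf_neq0.
Qed.

Lemma block_ge0 q t : 0 <= block q t.
Proof. by rewrite mulr_ge0 ?(ltW (mass_gt0 _))// riesz_ge0. Qed.

Lemma dpoly_block q : dpoly (top_digit nk (block_end nk (u q.+1))).+1 (block q).
Proof. by apply: dpolyZ; exact: dpoly_riesz. Qed.

Lemma block_end_leq : {homo (fun q => block_end nk (u q)) : p q / (p <= q)%N}.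
Proof.
apply: (homo_leq leqnn leq_trans) => q; have [h _ _ _] := uP q.
by rewrite (leq_trans h)// leq_addr.
Qed.

Lemma dpoly_partial p : dpoly (top_digit nk (nu p.+1)).+1 (partial p).
Proof.
apply: dpoly_sum => q _; apply: dpoly_leq (dpoly_block q).
rewrite ltnS top_leq// (leq_trans (block_end_leq (ltn_ord q)))//.
by have [] := uP p.
Qed.

Lemma partialS p t : partial p.+1 t = partial p t + block p t.
Proof. by rewrite /partial big_ord_recr. Qed.

Lemma partial_ge0 p t : 0 <= partial p t.
Proof. by apply: sumr_ge0 => q _; exact: block_ge0. Qed.

(** The heights at least double and a block is at most half of its height, so [height p + height
    p.+1 / 2 <= height p.+1]. *)
Lemma partial_le_height p t : partial p t <= height p.
Proof.
elim: p => [|p IH]; first by rewrite /partial big_ord0 ltW.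
rewrite partialS; have := double_height p.
by case: (block_values p t) => ->; have := height_gt0 p; lra.
Qed.

Lemma block_integrable q : mu.-integrable D (EFin \o block q).
Proof. exact: dpoly_integrableD (dpoly_block q). Qed.

Lemma integral_block q : (\int[mu]_(t in D) (block q t)%:E = (mass q)%:E)%E.
Proof.
rewrite -[LHS]fineK; last first.
  by apply: integrable_fin_num => //; exact: block_integrable.
congr EFin; rewrite -[LHS]/(\int[mu]_(t in D) block q t) /block RintegralZl//.
  by rewrite Rintegral_riesz// mulr1.
by apply: dpoly_integrableD; exact: dpoly_riesz.
Qed.

Lemma measurable_block q : measurable_fun setT (block q).
Proof. exact: dpoly_measurable (dpoly_block q). Qed.

(* A nonzero value of a block is at least [1], so the series at [t] converges
   only if it is eventually zero; otherwise [total t] is the junk value [0]. *)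
Lemma totalP t :
  (exists p, (forall q, (p <= q)%N -> block q t = 0) /\ total t = partial p t) \/
  ((\sum_(q <oo) (block q t)%:E = +oo)%E /\ total t = 0).
Proof.
have ge0 q : (0 <= (block q t)%:E)%E by rewrite lee_fin block_ge0.
have [[p p0]|no] := pselect (exists p, forall q, (p <= q)%N -> block q t = 0).
  left; exists p; split=> //; rewrite /total (nneseries_split 0 p)//.
  rewrite [X in (_ + X)%E]eseries0 => [|q pq _]; last by rewrite p0.
  by rewrite adde0 add0n sumEFin big_mkord.
right; suff oo : (\sum_(q <oo) (block q t)%:E = +oo)%E by rewrite /total oo.
apply/eqyP => A A0.
have [m Am] : exists m : nat, A <= m%:R.
  by exists (Num.truncn A).+1; exact/ltW/truncnS_gt.
have [p mp] : exists p, m%:R <= partial p t.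
  elim: m {Am} => [|m [p mp]]; first by exists 0%N; exact: partial_ge0.
  have [q pq q0] : exists2 q, (p <= q)%N & block q t != 0.
    apply: contrapT => h; apply: no; exists p => q pq; apply/eqP.
    by apply: contrapT => /negP q0; apply: h; exists q.
  exists q.+1; rewrite partialS -natr1 lerD//.
    rewrite (le_trans mp)// -(subnK pq); elim: (q - p)%N => [//|d IH].
    by rewrite addSn partialS (le_trans IH)// lerDl block_ge0.
  case: (block_values q t) q0 => [->|-> _]; first by rewrite eqxx.
  have := double_height q; suff : 1 <= height q by lra.
  by rewrite /height exprn_ege1// ler1n.
apply: (@le_trans _ _ (m%:R)%:E); first by rewrite lee_fin.
apply: (@le_trans _ _ (partial p t)%:E); first by rewrite lee_fin.
apply: le_trans (nneseries_lim_ge p _) => //.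
by rewrite /partial big_mkord sumEFin.
Qed.

Lemma total_ge0 t : 0 <= total t.
Proof. by case: (totalP t) => [[p [_ ->]]|[_ ->]]//; exact: partial_ge0. Qed.

(** Where the series diverges its tail is infinite, so the default value of [total] does no harm. *)
Lemma total_sub_partial p t :
  (`|total t - partial p t|%:E <= \sum_(p <= q <oo) (block q t)%:E)%E.
Proof.
have ge0 q : (0 <= (block q t)%:E)%E by rewrite lee_fin block_ge0.
have := nneseries_split 0 p (fun q _ => ge0 q); rewrite add0n sumEFin.
rewrite big_mkord -/(partial p t) => splitE.
case: (totalP t) => [[r [r0 tE]]|[oo t0]]; last first.
  suff -> : (\sum_(p <= q <oo) (block q t)%:E = +oo)%E by rewrite leey.
  move: splitE; rewrite oo.
  by case: (\sum_(p <= q <oo) _)%E => [v||].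
have fin : (\sum_(q <oo) (block q t)%:E = (total t)%:E)%E.
  rewrite tE (nneseries_split 0 r)// [X in (_ + X)%E]eseries0 => [|q rq _].
    by rewrite adde0 add0n sumEFin big_mkord.
  by rewrite r0.
have tail0 := @nneseries_ge0 _ _ xpredT p (fun q _ _ => ge0 q).
move: splitE tail0; rewrite fin; case: (\sum_(p <= q <oo) _)%E => [v||]//.
move=> [->]; rewrite !lee_fin => v0.
by rewrite addrAC subrr add0r ger0_norm.
Qed.

(** Chosen so that [weight q * block q t] is [phi (height q.+1)] wherever block [q] is nonzero. *)
Let weight q : R := phi (height q.+1) * 2 / height q.+1.

(** The last nonzero block [q] dominates: the partial sum is at most [height q.+1], so one term of
    the right-hand sum is enough. *)
Lemma phi_partial_le p t : phi (partial p t) <= phi 0 + \sum_(q < p) weight q * block q t.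
Proof.
elim: p => [|p IH]; first by rewrite /partial !big_ord0 addr0.
rewrite big_ord_recr /= partialS.
case: (block_values p t) => bE; rewrite bE; first by rewrite addr0 mulr0 addr0.
have phi0 := phi_ge0 (lexx (0 : R)).
have wE : weight p * (height p.+1 / 2) = phi (height p.+1).
  by rewrite /weight; field; rewrite lt0r_neq0.
have w0 q : 0 <= weight q * block q t.
  rewrite mulr_ge0 ?block_ge0// /weight divr_ge0 ?mulr_ge0 ?(ltW (height_gt0 _))//.
  by rewrite phi_ge0// ltW.
have sum0 : 0 <= \sum_(q < p) weight q * block q t by apply: sumr_ge0.
rewrite wE; apply: (@le_trans _ _ (phi (height p.+1))).
  apply: phi_le; first by rewrite addr_ge0 ?partial_ge0// divr_ge0 ?(ltW (height_gt0 _)).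
  by have := partial_le_height p t; have := double_height p; lra.
by rewrite addrA lerDr addr_ge0.
Qed.

Lemma weight_ge0 q : 0 <= weight q.
Proof. by rewrite /weight divr_ge0 ?mulr_ge0 ?(ltW (height_gt0 _))// phi_ge0// ltW. Qed.

Lemma phi_total_le t :
  ((phi `|total t|)%:E <= (phi 0)%:E + \sum_(q <oo) (weight q * block q t)%:E)%E.
Proof.
have ge0 q : (0 <= (weight q * block q t)%:E)%E.
  by rewrite lee_fin mulr_ge0 ?block_ge0 ?weight_ge0.
rewrite ger0_norm ?total_ge0//.
case: (totalP t) => [[p [_ ->]]|[_ ->]]; last by rewrite leeDl// nneseries_ge0.
apply: (@le_trans _ _ ((phi 0)%:E + (\sum_(q < p) weight q * block q t)%:E)%E).
  by rewrite -EFinD lee_fin phi_partial_le.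
rewrite leeD2l//; apply: le_trans (nneseries_lim_ge p _) => //.
by rewrite big_mkord sumEFin.
Qed.

Lemma measurable_total : measurable_fun setT total.
Proof.
apply: (@measurableT_comp _ _ _ _ _ _ (@fine R)); first exact: fine_measurable.
apply: ge0_emeasurable_sum => [q t _ _|q _]; first by rewrite lee_fin block_ge0.
by apply/measurable_EFinP; exact: measurable_block.
Qed.

Lemma geometric_nneseries (a : nat -> R) : (forall q, 0 <= a q <= 1 / (2 ^ q.+1)%:R) ->
  (\sum_(q <oo) (a q)%:E <= 1)%E.
Proof.
move=> aP; apply: le_trans (epsilon_trick0 xpredT (@ler01 R)).
by apply: lee_nneseries => q *; rewrite lee_fin; have /andP[] := aP q.
Qed.

Lemma phiL_total : phiL phi total.
Proof.
split; first exact: measurable_funTS measurable_total.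
have mphi : measurable_fun D (fun t => (phi `|total t|)%:E).
  apply/measurable_EFinP; apply: measurable_funTS.
  (* [phi] is monotone on nonnegative arguments only; truncation at [0] makes it monotone, hence
     measurable, on the whole line. *)
  rewrite (_ : (fun t => _) = (fun v => phi (Num.max 0 v)) \o total); last first.
    by apply/funext => t /=; rewrite ger0_norm ?total_ge0// max_r// total_ge0.
  apply: measurableT_comp measurable_total; apply: nondecreasing_measurable => // v w vw.
  by apply: phi_le; rewrite ?ge_max !le_max lexx ?vw ?orbT.
have mwb q : measurable_fun D (fun t => (weight q * block q t)%:E).
  apply/measurable_EFinP; apply: measurable_funM => //; apply: measurable_funTS.
  exact: measurable_block.
have wb0 q t : D t -> (0 <= (weight q * block q t)%:E)%E.
  by move=> _; rewrite lee_fin mulr_ge0 ?weight_ge0 ?block_ge0.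
have msum : measurable_fun D (fun t => \sum_(q <oo) (weight q * block q t)%:E)%E.
  by apply: ge0_emeasurable_sum => [q t Dt _|q _]; [exact: wb0|exact: mwb].
apply: (@le_lt_trans _ _ (\int[mu]_(t in D)
    ((phi 0)%:E + \sum_(q <oo) (weight q * block q t)%:E))%E).
  apply: ge0_le_integral => //.
  - by move=> t _; rewrite lee_fin phi_ge0.
  - by apply: emeasurable_funD => //; exact: measurable_cst.
  - by move=> t _; exact: phi_total_le.
rewrite ge0_integralD//; last 2 first.
- by move=> t _; rewrite lee_fin phi_ge0.
- by move=> t Dt; apply: nneseries_ge0 => q _ _; exact: wb0.
rewrite integral_cst// [X in (_ * X + _)%E](_ : _ = 1%E); last exact: lebesgue_unit_itv.
rewrite mule1 integral_nneseries//.
rewrite (eq_eseriesr (g := fun q => (weight q * mass q)%:E)) => [|q _]; last first.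
  under eq_integral do rewrite EFinM.
  rewrite ge0_integralZl//; last 3 first.
  - by apply/measurable_EFinP; apply: measurable_funTS; exact: measurable_block.
  - by move=> t _; rewrite lee_fin block_ge0.
  - by rewrite lee_fin weight_ge0.
  by rewrite integral_block -EFinM.
apply: (@le_lt_trans _ _ ((phi 0)%:E + 1)%E); last by rewrite -EFinD ltry.
rewrite leeD2l//; apply: geometric_nneseries => q.
rewrite mulr_ge0 ?weight_ge0 ?(ltW (mass_gt0 _))//=.
(* [weight q * mass q] is exactly the quantity bounded by the last condition of [good_block]. *)
have [_ _ _] := uP q; rewrite -/(nu q.+1) -/(height q.+1); apply: le_trans.
rewrite le_eqVlt; apply/orP; left; apply/eqP.
rewrite /weight /mass exprS; field.
by rewrite lt0r_neq0//= expf_neq0.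
Qed.

Lemma integral_total_sub_partial p :
  (\int[mu]_(t in D) `|total t - partial p t|%:E <= \sum_(p <= q <oo) (mass q)%:E)%E.
Proof.
have mb q : measurable_fun D (fun t => (block q t)%:E).
  by apply/measurable_EFinP; apply: measurable_funTS; exact: measurable_block.
have b0 q t : (0 <= (block q t)%:E)%E by rewrite lee_fin block_ge0.
rewrite -nneseries_addn; last by move=> q; rewrite lee_fin ltW.
apply: (@le_trans _ _ (\int[mu]_(t in D) (\sum_(q <oo) (block (q + p) t)%:E))%E).
  apply: ge0_le_integral => //.
  - apply/measurable_EFinP; apply: measurable_funTS; apply: measurableT_comp => //.
    apply: measurable_funB; first exact: measurable_total.
    exact: dpoly_measurable (dpoly_partial p).
  - by apply: ge0_emeasurable_sum => [q t _ _|q _]; [exact: b0|exact: mb].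
  - move=> t _; rewrite (nneseries_addn (f := fun q => (block q t)%:E))//.
    exact: total_sub_partial.
rewrite (@integral_nneseries _ _ _ mu _ _
  (fun q t => (block (q + p) t)%:E))//; last first.
  by move=> q; exact: mb.
by apply: lee_nneseries => q *; rewrite ?integral_block// lee_fin ltW.
Qed.

Lemma total_integrable : mu.-integrable D (EFin \o total).
Proof.
apply/integrableP; split.
  by apply/measurable_EFinP; apply: measurable_funTS; exact: measurable_total.
have := integral_total_sub_partial 0.
under eq_integral do rewrite /partial big_ord0 subr0.
move=> /le_lt_trans; apply; apply: le_lt_trans (ltry 1).
apply: geometric_nneseries => q; rewrite ltW//=.
have [_ _ + _] := uP q; apply: le_trans.
by rewrite ler_peMl ?(ltW (mass_gt0 _))// ler1n nk_gt0.
Qed.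

(** A partial sum of order [n] is at most [n] times the integral of the absolute value, and by the
    third condition of [good_block] the products [nk k * mass r], [q <= r], are dominated by a
    geometric series of sum [1]. *)
Lemma walsh_sum_tail q k x : (k <= block_end nk (u q))%N ->
  `|walsh_sum (nk k) (fun t => total t - partial q t) x| <= 1.
Proof.
move=> kq; have pi : mu.-integrable D (EFin \o (fun t => - partial q t)).
  apply: dpoly_integrableD (_ : dpoly (top_digit nk (nu q.+1)).+1 _).
  by apply: dpoly_ext (dpolyZ (-1) (dpoly_partial q)) => t; rewrite mulN1r.
have fi : mu.-integrable D (EFin \o (fun t => total t - partial q t)).
  by apply: eq_integrable (integrableD _ total_integrable pi) => // t _.
apply: (le_trans (walsh_sum_bound _ _ fi)).
have mass_bound r : (q <= r)%N -> (nk k)%:R * mass r <= 1 / (2 ^ r.+1)%:R.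
  move=> qr; have [_ _ + _] := uP r; apply: le_trans.
  by rewrite ler_pM2r ?mass_gt0// ler_nat nested_leq// (leq_trans kq)// block_end_leq.
have afi : mu.-integrable D (EFin \o (fun t => `|total t - partial q t|)).
  exact: integrable_norm fi.
rewrite -lee_fin EFinM /Rintegral fineK; last first.
  by apply: integrable_fin_num => //; exact: afi.
apply: (@le_trans _ _ ((nk k)%:R%:E * \sum_(q <= r <oo) (mass r)%:E)%E).
  by rewrite lee_pmul2l ?lte_fin ?ltr0n// integral_total_sub_partial.
rewrite -nneseriesZl// => [|r _]; last by rewrite lee_fin ltW.
apply: le_trans (geometric_nneseries
  (a := fun r => if (q <= r)%N then (nk k)%:R * mass r else 0) _).
  rewrite eseries_cond eseries_mkcond; apply: lee_nneseries => r *.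
    by case: ifP => //=; rewrite lee_fin mulr_ge0// ltW.
  by rewrite /=; case: ifP.
move=> r; case: ifP => [qr|_]; last by rewrite lexx divr_ge0.
by rewrite mass_bound// mulr_ge0// ltW.
Qed.

(** Split [total] into the earlier blocks, block [q] and the tail. The order [nk k] reproduces the
    first, at most [height q]; the second gives at least [height q + q]; the tail gives at most
    [1]. *)
Lemma walsh_sum_total_lower_bound q x :
  exists k, q%:R - 1 <= `|walsh_sum (nk k) total x|.
Proof.
have len : (2 ^ (top_digit nk (nu q.+1)).+1 <= block_length nk (u q.+1))%N.
  by rewrite (leq_trans _ (leq_addr _ _))// expnS leq_mul2l leq_top.
have [k /andP[nuk kend] bk] := walsh_sum_riesz_lower_bound nkP x len.
exists k.
have bi := block_integrable q.
have pm := dpoly_partial q; have pi := dpoly_integrableD pm.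
have p1i : mu.-integrable D (EFin \o (fun t => - partial q.+1 t)).
  apply: (@dpoly_integrableD _ (top_digit nk (nu q.+2)).+1).
  by apply: dpoly_ext (dpolyZ (-1) (dpoly_partial q.+1)) => t; rewrite mulN1r.
have ti : mu.-integrable D (EFin \o (fun t => total t - partial q.+1 t)).
  by apply: eq_integrable (integrableD _ total_integrable p1i).
have E : walsh_sum (nk k) total x = partial q x + walsh_sum (nk k) (block q) x +
    walsh_sum (nk k) (fun t => total t - partial q.+1 t) x.
  rewrite -(walsh_sum_dpoly (n := nk k) x pm); last first.
    by rewrite (leq_trans _ (leq_top nkP k))// leq_exp2l// top_ltn.
  rewrite -walsh_sumD// -walsh_sumD//; last by apply: eq_integrable (integrableD _ pi bi).
  by congr (walsh_sum _ _ x); apply/funext => t; rewrite partialS; ring.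
have tail := walsh_sum_tail x kend.
have ph := partial_le_height q x; have p0 := partial_ge0 q x.
have bb : height q + q%:R <= `|walsh_sum (nk k) (block q) x|.
  have [_ + _ _] := uP q; move=> h; apply: (le_trans h).
  rewrite /block walsh_sumZ; last by apply: dpoly_integrableD; exact: dpoly_riesz.
  by rewrite normrM ger0_norm ?(ltW (mass_gt0 _))// ler_pM2l.
rewrite E; move: bb tail; set a := walsh_sum _ _ _; set b := walsh_sum _ _ _ => bb tail.
have := ler_normB (partial q x + a + b) (partial q x + b).
rewrite (_ : partial q x + a + b - (partial q x + b) = a); last by ring.
have := ler_normD (partial q x) b; rewrite (ger0_norm p0).
lra.
Qed.

End DivergentFunction.

Theorem theorem2p6 (R : realType) (nk : nat -> nat)
  (nk_nested : nested_spectrums nk)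
  (nk_unbounded :
    ereal_sup (range (fun k => ((bin_variation (nk k))%:R : R)%:E)) = +oo%E)
  (phi : R -> R) (phi_Phi : Phi phi)
  (phi_o : forall u : R, phi u =o_(u \near pinfty_nbhs R) phi_seq nk u) :
  exists f : R -> R, phiL phi f /\
    forall x : R, unit_itv x ->
      ereal_sup (range (fun k => `|walsh_sum (nk k) f x|%:E)) = +oo%E.
Proof.
have [phi_nondecr _] := phi_Phi.
have [next nextP] := choice (fun qp : nat * (nat * nat) =>
  good_block_exists nk_nested qp.1 qp.2 nk_unbounded phi_o).
pose u := fix u q := if q is q'.+1 then next (q', u q') else (0%N, 0%N).
have uP q : good_block nk phi q (u q) (u q.+1) by exact: nextP (q, u q).
exists (@total R nk u); split; first exact: (phiL_total nk_nested phi_nondecr uP).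
move=> x _; apply/eqyP => A _.
(* After the loss of [1] the bound is [Num.truncn A + 1], which exceeds [A]. *)
have [k Ak] := walsh_sum_total_lower_bound nk_nested uP (Num.truncn A).+2 x.
apply: (@le_trans _ _ `|walsh_sum (nk k) (@total R nk u) x|%:E); last first.
  by apply: ereal_sup_ubound; exists k.
rewrite lee_fin (le_trans _ Ak)// -natr1 addrK.
exact/ltW/truncnS_gt.
Qed.
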